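(* For integers $d\ge1$ and $a$ put $H(x;d,a)=\sum_{p^r\le x,\ r\ge1,\ p\equiv a\ (\mathrm{mod}\ d)}\frac{\log p}{p^r}$, and define $$C_+(d,a)=\sup_{x\ge1}\Big(H(x;d,a)-\tfrac12\log x\Big),\qquad C_-(d,a)=\inf_{x\ge1}\Big(H(x;d,a)-\tfrac12\log x\Big).$$ Then: (a) $C_-(4,1)>-1.202$ and $C_+(4,1)=0$; (b) $C_-(4,3)=\frac{\log 3}{3}-\frac{\log 7}{2}=-0.606750\ldots$ and $C_+(4,3)=0$; (c) $C_-(3,1)>-1.4$ and $C_+(3,1)=0$; (d) $C_-(3,2)=-\frac{\log 2}{2}=-0.34657\ldots$ and $C_+(3,2)<0.2764$.
   Context: Here $p$ runs over primes and $r$ over positive integers. (In the paper's notation, $H(x;d,a)=\sum_{n\le x}\Lambda_{g_{d,a}}(n)/n$, where $\Lambda_{g_{d,a}}(n)=\log p$ if $n=p^r$ with $r\ge1$ and $p\equiv a\pmod d$, and $0$ otherwise, and $C_\pm(d,a)$ are the quantities $C_\pm(g_{d,a})$ with $\tau=1/2$.) *)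

(* Defs.v *)
From Stdlib Require Import Reals ZArith.
From mathcomp Require Import ssreflect ssrbool ssrnat eqtype seq div prime.

Open Scope R_scope.

(* Lambda_{g_{d,a}}(n) = log p if n = p^r (r >= 1, p prime) and p = a (mod d),
   and 0 otherwise.  n is a prime power p^r with r >= 1 iff primes n = [:: p]. *)
Definition LambdaDA (d a n : nat) : R :=
  match primes n with
  | [:: p] => if (p %% d == a %% d)%N then ln (INR p) else 0
  | _ => 0
  end.

Definition H (x : R) (d a : nat) : R :=
  foldr Rplus 0
    (map (fun n => LambdaDA d a n / INR n) (iota 1 (Z.to_nat (Int_part x)))).

Definition Fda (d a : nat) (x : R) : R := H x d a - ln x / 2.

Definition valsF (d a : nat) : R -> Prop :=
  fun y => exists x, 1 <= x /\ y = Fda d a x.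

Definition is_lower_bound (E : R -> Prop) (m : R) := forall y, E y -> m <= y.
Definition is_glb (E : R -> Prop) (m : R) :=
  is_lower_bound E m /\ (forall b, is_lower_bound E b -> b <= m).

Definition Cplus_is (d a : nat) (c : R) : Prop := is_lub (valsF d a) c.
Definition Cminus_is (d a : nat) (c : R) : Prop := is_glb (valsF d a) c.

(* Main.v *)
(* Let chi be the nonprincipal character mod d (d = 3, 4), with S_0 and S_chi the sums of
   Lambda(n)/n and chi(n) Lambda(n)/n over n <= N. Up to a sum over even prime powers and the
   ramified prime, 2 H(N; d, 1) = S_0 + S_chi and 2 H(N; d, -1) = S_0 - S_chi.
   As in Chebyshev's method, log = Lambda * 1 makes the sums of Lambda(n)/n G_0(N/n) and
   chi(n) Lambda(n)/n G_chi(N/n) explicit for kernels G(m) = sum_j c_j sum_(k <= m/j) f(k)/k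
   with f = 1 or chi. For suitable finitely supported c the normalised kernels are 1 + O(1/m)
   and very close to 1 for small m, so psi(N) <= 2 N log 2 bounds the discrepancy: H is
   (log N)/2 plus a known constant up to an error below 0.19 for N >= 2000. The remaining N
   are checked with integer fixed-point enclosures of the logarithms. *)
Require Import Defs.
From Stdlib Require Import Reals Lra Lia Psatz ZArith.
From Coquelicot Require Import Coquelicot.
From mathcomp Require Import all_boot zify.
Set Implicit Arguments.
Unset Strict Implicit.
Unset Printing Implicit Defensive.
Open Scope R_scope.

(** * Finite sums and the von Mangoldt function *)

(** The obstacle is that [psi_le] loses a constant factor, so the kernels must be accurate exactly
    where that loss is expensive. With m = floor(N/n) one has 1/n <= (m+1)/N, so the discrepancy of
    the term n is governed by (m+1)|1 - G(m)|. This quantity is dominated by a staircase in m; a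
    step of height h at k costs h psi(N/k)/N <= 2 h log 2 / k, so early steps must be tiny and a
    large late one is cheap. Finitely many steps suffice because G(m) = sum_(k <= m) eta(k)/k with
    eta periodic of mean zero, whence (m+1)|1 - G(m)| is bounded. For f = 1 the harmonic sums
    diverge and the condition sum_j c_j = 0 is forced; for chi there is no such condition, the
    kernel tending to L(1,chi) sum_j c_j. The constants that come out are numerical stand-ins for
    -gamma and -L'/L(1,chi). *)

Fixpoint sum1 (f : nat -> R) (n : nat) : R :=
  if n is m.+1 then sum1 f m + f m.+1 else 0.

Lemma sum1_ext f g n :
  (forall k, (0 < k <= n)%N -> f k = g k) -> sum1 f n = sum1 g n.
Proof.
elim: n => //= n IH Hfg; rewrite Hfg ?IH //; last by lia.
by move=> k Hk; apply: Hfg; lia.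
Qed.

Lemma sum1_le f g n :
  (forall k, (0 < k <= n)%N -> f k <= g k) -> sum1 f n <= sum1 g n.
Proof.
elim: n => [|n IH] /= Hfg; first lra.
have H1 : f n.+1 <= g n.+1 by apply: Hfg; lia.
have H2 : sum1 f n <= sum1 g n by apply: IH => k Hk; apply: Hfg; lia.
lra.
Qed.

Lemma sum1_plus f g n : sum1 (fun k => f k + g k) n = sum1 f n + sum1 g n.
Proof. by elim: n => [|n IH] /=; [lra | rewrite IH; lra]. Qed.

Lemma sum1_minus f g n : sum1 (fun k => f k - g k) n = sum1 f n - sum1 g n.
Proof. by elim: n => [|n IH] /=; [lra | rewrite IH; lra]. Qed.

Lemma sum1_scal c f n : sum1 (fun k => c * f k) n = c * sum1 f n.
Proof. by elim: n => [|n IH] /=; [lra | rewrite IH; lra]. Qed.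

Lemma sum1_zero f n : (forall k, (0 < k <= n)%N -> f k = 0) -> sum1 f n = 0.
Proof.
move=> Hf; rewrite (@sum1_ext f (fun => 0)) //.
by elim: n {Hf} => //= n ->; lra.
Qed.

Lemma sum1_ge0 f n : (forall k, (0 < k <= n)%N -> 0 <= f k) -> 0 <= sum1 f n.
Proof.
move=> Hf; rewrite -(@sum1_zero (fun => 0) n) //; exact: sum1_le.
Qed.

Lemma sum1_abs f n : Rabs (sum1 f n) <= sum1 (fun k => Rabs (f k)) n.
Proof.
elim: n => [|n IH] /=; first by rewrite Rabs_R0; lra.
by have := Rabs_triang (sum1 f n) (f n.+1); lra.
Qed.

Lemma sum1_mono f m n :
  (m <= n)%N -> (forall k, (m < k <= n)%N -> 0 <= f k) -> sum1 f m <= sum1 f n.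
Proof.
move=> Hmn; elim: n Hmn => [|n IH] Hmn Hf; first by (have -> : m = 0%N by lia); lra.
case: (eqVneq m n.+1) => [->|Hne]; first lra.
have H1 : sum1 f m <= sum1 f n by apply: IH => [|k Hk]; [lia | apply: Hf; lia].
have H2 : 0 <= f n.+1 by apply: Hf; lia.
rewrite /=; lra.
Qed.

Lemma sum1_extend f m n :
  (m <= n)%N -> (forall k, (m < k <= n)%N -> f k = 0) -> sum1 f n = sum1 f m.
Proof.
move=> Hmn; elim: n Hmn => [|n IH] Hmn Hf; first by (have -> : m = 0%N by lia).
case: (eqVneq m n.+1) => [->//|Hne].
rewrite /= Hf; last lia.
rewrite IH; [lra | lia | by move=> k Hk; apply: Hf; lia].
Qed.

Lemma sum1_swap (F : nat -> nat -> R) m n :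
  sum1 (fun i => sum1 (F i) n) m = sum1 (fun j => sum1 (F^~ j) m) n.
Proof.
elim: m => [|m IH] /=; first by rewrite sum1_zero.
by rewrite IH -sum1_plus.
Qed.

Lemma sum1_single f n a :
  (0 < a <= n)%N -> (forall k, (0 < k <= n)%N -> k != a -> f k = 0) ->
  sum1 f n = f a.
Proof.
elim: n => [|n IH] Ha Hf; first lia.
case: (eqVneq a n.+1) => [Ea|Hne] /=.
  rewrite sum1_zero; first by rewrite Ea; lra.
  by move=> k Hk; apply: Hf; lia.
rewrite (Hf n.+1); [|lia|by rewrite eq_sym].
rewrite IH; [lra|lia|by move=> k Hk; apply: Hf; lia].
Qed.

Lemma sum1_dvd f j N :
  (0 < j)%N ->
  sum1 (fun k => if (j %| k)%N then f (k %/ j)%N else 0) N = sum1 f (N %/ j)%N.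
Proof.
move=> Hj; elim: N => [|N IH] /=; first by rewrite div0n.
rewrite IH divnS //; case: (j %| N.+1)%N => /=; last by rewrite add0n; lra.
by rewrite add1n.
Qed.

Lemma sum1_convolution (F : nat -> nat -> R) N :
  sum1 (fun k => sum1 (fun n => if (n %| k)%N then F n (k %/ n)%N else 0) k) N =
  sum1 (fun n => sum1 (F n) (N %/ n)%N) N.
Proof.
transitivity
  (sum1 (fun k => sum1 (fun n => if (n %| k)%N then F n (k %/ n)%N else 0) N) N).
  apply: sum1_ext => k Hk; symmetry; apply: sum1_extend; first lia.
  move=> n Hn; case: ifP => // /dvdn_leq; lia.
rewrite sum1_swap; apply: sum1_ext => n Hn; apply: sum1_dvd; lia.
Qed.

Definition Lam (n : nat) : R := if primes n is [:: p] then ln (INR p) else 0.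

Lemma INR_gt0 n : (0 < n)%N -> 0 < INR n.
Proof. by move=> Hn; apply: lt_0_INR; lia. Qed.

Lemma INR_ge1 n : (0 < n)%N -> 1 <= INR n.
Proof. by move=> Hn; rewrite -INR_1; apply: le_INR; lia. Qed.

Lemma ln_ge0 x : 1 <= x -> 0 <= ln x.
Proof. by move=> Hx; rewrite -ln_1; case: Hx => [H|->]; [left; apply: ln_increasing; lra | lra]. Qed.

Lemma ln_le_mono x y : 0 < x -> x <= y -> ln x <= ln y.
Proof. by move=> Hx; case=> [H|->]; [left; apply: ln_increasing; lra | lra]. Qed.

Lemma Lam_prime_power p r : prime p -> (0 < r)%N -> Lam (p ^ r)%N = ln (INR p).
Proof. by move=> Hp Hr; rewrite /Lam primesX // primes_prime. Qed.

Lemma primes1_eq n p : primes n = [:: p] -> prime p /\ exists2 r, (0 < r)%N & n = (p ^ r)%N.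
Proof.
move=> En; have Hp : p \in primes n by rewrite En inE.
move: (Hp); rewrite mem_primes => /and3P[Pp Hn Hd].
split=> //; exists (logn p n); first by rewrite logn_gt0.
rewrite {1}(prod_prime_decomp Hn) prime_decompE En /=.
by rewrite big_seq1.
Qed.

Variant Lam_spec n : R -> Prop :=
| LamPrimePower p r of prime p & (0 < r)%N & n = (p ^ r)%N : Lam_spec n (ln (INR p))
| LamOther of (forall p r, prime p -> (0 < r)%N -> n <> (p ^ r)%N) : Lam_spec n 0.

Lemma LamP n : Lam_spec n (Lam n).
Proof.
have Hno : (forall p, primes n <> [:: p]) -> Lam_spec n 0.
  move=> H; apply: LamOther => p r Pp Hr En; apply: (H p).
  by rewrite En primesX // primes_prime.
rewrite /Lam; case E: (primes n) => [|p [|q s]].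
- by apply: Hno => p; rewrite E.
- by case: (primes1_eq E) => Pp [r Hr En]; apply: LamPrimePower Hr En.
- by apply: Hno => x; rewrite E.
Qed.

Lemma Lam_ge0 n : 0 <= Lam n.
Proof.
by case: LamP => [p r Pp _ _|_]; [apply/ln_ge0/INR_ge1/prime_gt0 | lra].
Qed.

Lemma Lam_le n : (0 < n)%N -> Lam n <= ln (INR n).
Proof.
move=> Hn; case: LamP => [p r Pp Hr ->|_]; last exact/ln_ge0/INR_ge1.
apply: ln_le_mono; first exact/INR_gt0/prime_gt0.
apply/le_INR/leP; rewrite -{1}[p]expn1 leq_pexp2l //; exact: prime_gt0.
Qed.

(** Strong induction, removing one prime: if k = m p, the only prime power dividing k but not m is
    p^(v_p(m)+1), and it contributes exactly log p. *)
Lemma ln_sum_Lam k :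
  (0 < k)%N -> ln (INR k) = sum1 (fun n => if (n %| k)%N then Lam n else 0) k.
Proof.
elim/ltn_ind: k => k IH Hk.
case: (ltnP 1 k) => [Hk1|Hk1]; last first.
  have -> : k = 1%N by lia.
  by rewrite /= /Lam /= ln_1; lra.
have Pp := pdiv_prime Hk1; set p := pdiv k in Pp.
have [m Em] : exists m, k = (m * p)%N by apply/dvdnP; exact: pdiv_dvd.
have Hp2 := prime_gt1 Pp.
have Hm : (0 < m)%N by move: Hk; rewrite Em; case: (m).
have Hmk : (m < k)%N by rewrite Em -{1}[m]muln1 ltn_pmul2l.
set a := (p ^ (logn p m).+1)%N.
have Ha0 : (0 < a)%N by rewrite expn_gt0 prime_gt0.
have Hak : (a %| k)%N by rewrite Em /a expnSr dvdn_pmul2r ?prime_gt0 // pfactor_dvdnn.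
have Ham : ~~ (a %| m)%N by rewrite pfactor_dvdn // ltnn.
have -> : ln (INR k) = ln (INR m) + ln (INR p).
  by rewrite Em mult_INR ln_mult //; apply: INR_gt0; lia.
rewrite (IH _ Hmk Hm) -(@sum1_extend _ m k); [|lia|].
2: by move=> n Hn; case: ifP => // /dvdn_leq; lia.
have -> : ln (INR p) =
  sum1 (fun n => (if (n %| k)%N then Lam n else 0) - (if (n %| m)%N then Lam n else 0)) k.
  rewrite (@sum1_single _ k a).
  - by rewrite Hak (negbTE Ham) Lam_prime_power //; lra.
  - by rewrite Ha0 dvdn_leq.
  move=> n Hn Hna; case Hnm: (n %| m)%N.
    by rewrite Em dvdn_mulr //; lra.
  case Hnk: (n %| k)%N; last lra.
  case: LamP => [q r Pq Hr En|_]; last lra.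
  exfalso; move: Hnk Hnm; rewrite Em En !pfactor_dvdn ?muln_gt0 ?Hm ?(prime_gt0 Pp) //.
  rewrite lognM ?(prime_gt0 Pp) // (logn_prime q Pp); case: eqVneq => [Eqp|_] /=; last by rewrite addn0 => ->.
  move=> H1 H2; move/negP: Hna; apply; apply/eqP; rewrite En /a Eqp; congr (_ ^ _)%N.
  by move: H1 H2; rewrite Eqp; lia.
by rewrite -sum1_plus; apply: sum1_ext => n _; lra.
Qed.

(** * Convolution identities and Chebyshev bound *)

(** Complete multiplicativity turns log = Lambda * 1 into f log = (f Lambda) * f; summing over k <=
    N leaves partial sums of f as inner sums. *)
Lemma mult_log_convolution (f : nat -> R) N :
  (forall n m, (0 < n)%N -> (0 < m)%N -> f (n * m)%N = f n * f m) ->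
  sum1 (fun k => f k * ln (INR k)) N =
  sum1 (fun n => f n * Lam n * sum1 f (N %/ n)%N) N.
Proof.
move=> Hf.
rewrite (@sum1_ext (fun n => f n * Lam n * sum1 f (N %/ n)%N)
  (fun n => sum1 (fun m => f n * Lam n * f m) (N %/ n)%N)); last first.
  by move=> n _; rewrite sum1_scal.
rewrite -(sum1_convolution (fun n m => f n * Lam n * f m)).
apply: sum1_ext => k Hk; rewrite ln_sum_Lam; last lia.
rewrite -sum1_scal; apply: sum1_ext => n Hn.
case: ifP => [/dvdnP[m Em]|_]; last lra.
have Hm : (0 < m)%N by move: Hk; rewrite Em; case: (m).
rewrite Em mulnK; last lia.
rewrite mulnC Hf //; [ring|lia].
Qed.

Definition logfact (N : nat) : R := sum1 (fun k => ln (INR k)) N.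

Definition psi (N : nat) : R := sum1 Lam N.

Lemma sum1_const c n : sum1 (fun=> c) n = c * INR n.
Proof. by elim: n => [|n IH]; rewrite ?S_INR /= ?IH; lra. Qed.

(** Legendre's formula. The free upper limit M lets factorials of different sizes be expanded over
    one common range. *)
Lemma logfact_Lam N M : (N <= M)%N ->
  logfact N = sum1 (fun n => Lam n * INR (N %/ n)%N) M.
Proof.
move=> HNM; have := @mult_log_convolution (fun=> 1) N.
rewrite (@sum1_ext _ (fun k => ln (INR k))); last by move=> k _; lra.
rewrite -/(logfact N) => ->; last by move=> *; lra.
rewrite [RHS](@sum1_extend _ N M) //; last first.
  by move=> k Hk; rewrite divn_small /=; [lra|lia].
by apply: sum1_ext => n Hn; rewrite sum1_const; lra.
Qed.

(** The right side is the logarithm of a binomial coefficient, in which Lambda(n) has the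
    coefficient floor((a+b)/n) - floor(a/n) - floor(b/n). It is never negative, and it is at least 1
    for b < n <= a+b, since a <= b < n kills the last two floors. *)
Lemma psi_sub_le a b : (a <= b)%N ->
  psi (a + b)%N - psi b <= logfact (a + b)%N - logfact a - logfact b.
Proof.
move=> Hab.
have -> : psi b = sum1 (fun n => if (n <= b)%N then Lam n else 0) (a + b)%N.
  rewrite (@sum1_extend _ b (a + b)%N); [|lia|by move=> k Hk; case: ifP => //; lia].
  by apply: sum1_ext => k Hk; case: ifP => //; lia.
rewrite (@logfact_Lam (a + b) (a + b)%N) // (@logfact_Lam a (a + b)%N); last lia.
rewrite (@logfact_Lam b (a + b)%N); last lia.
rewrite -!sum1_minus; apply: sum1_le => n Hn.
have H0 := Lam_ge0 n.
have H1 : (a %/ n + b %/ n <= (a + b) %/ n)%N by rewrite leq_divRL ?mulnDl; [apply: leq_add; exact: leq_divM | lia].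
have H1' : INR (a %/ n)%N + INR (b %/ n)%N <= INR ((a + b) %/ n)%N.
  by rewrite -plus_INR; apply: le_INR; apply/leP.
case: ifP => Hnb; first by nra.
rewrite (@divn_small a); last lia. rewrite (@divn_small b); last lia.
have : 1 <= INR ((a + b) %/ n)%N by apply: INR_ge1; rewrite divn_gt0; lia.
rewrite /=; nra.
Qed.

Lemma ln_mult_le a b c d : 0 < a -> 0 < b -> 0 < c -> 0 < d ->
  a * b <= c * d -> ln a + ln b <= ln c + ln d.
Proof.
move=> Ha Hb Hc Hd H; rewrite -!ln_mult //; apply: ln_le_mono => //; exact: Rmult_lt_0_compat.
Qed.

Lemma ln4 : ln 4 = 2 * ln 2.
Proof. by rewrite (_ : 4 = 2 * 2) ?ln_mult; lra. Qed.

Lemma logfactS N : logfact N.+1 = logfact N + ln (INR N.+1).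
Proof. by []. Qed.

(** The central binomial coefficient is at most 4^M, because consecutive ones have ratio
    (2M+1)(2M+2)/(M+1)^2 <= 4. The odd case has the ratio (2M+2)(2M+3)/((M+1)(M+2)), again at most
    4. *)
Lemma logfact_central_even M :
  logfact (M + M)%N - 2 * logfact M <= INR M * (2 * ln 2).
Proof.
elim: M => [|M IH]; first by rewrite addn0 /logfact /=; lra.
have -> : (M.+1 + M.+1)%N = (M + M).+2 by lia.
rewrite !logfactS !S_INR plus_INR; have HM := pos_INR M.
have := @ln_mult_le (INR M + INR M + 1) (INR M + INR M + 1 + 1) (4 * (INR M + 1)) (INR M + 1).
rewrite (@ln_mult 4); [|lra|lra]; rewrite ln4 => H.
have {}H := H ltac:(lra) ltac:(lra) ltac:(lra) ltac:(lra) ltac:(nra).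
lra.
Qed.

Lemma logfact_central_odd M :
  logfact (M + M.+1)%N - logfact M - logfact M.+1 <= INR M * (2 * ln 2).
Proof.
elim: M => [|M IH]; first by rewrite add0n /logfact /= ln_1; lra.
have -> : (M.+1 + M.+2)%N = (M + M.+1).+2 by lia.
rewrite !logfactS !S_INR plus_INR !S_INR in IH *; have HM := pos_INR M.
have := @ln_mult_le (INR M + (INR M + 1) + 1) (INR M + (INR M + 1) + 1 + 1)
   (4 * (INR M + 1)) (INR M + 1 + 1).
rewrite (@ln_mult 4); [|lra|lra]; rewrite ln4 => H.
have {}H := H ltac:(lra) ltac:(lra) ltac:(lra) ltac:(lra) ltac:(nra).
lra.
Qed.

(** Halving: psi(N) exceeds psi of the upper half of N by at most 2 log 2 times the lower half, and
    the two halves add up to N, so the induction closes with no loss. N = 0 and N = 1 are separate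
    because halving does not make progress there. *)
Lemma psi_le N : psi N <= 2 * ln 2 * INR N.
Proof.
have Hln2 : 0 <= ln 2 by apply: ln_ge0; lra.
elim/ltn_ind: N => N IH.
have [E|E] : N = (N./2 + N./2)%N \/ N = (N./2 + N./2.+1)%N.
- by have := odd_double_half N; case: (odd N); lia.
- set M := N./2 in E; case: (posnP M) => HM.
    by rewrite E HM /psi /=; lra.
  have H1 := @psi_sub_le M M (leqnn _).
  have H2 := logfact_central_even M.
  have := IH M; rewrite {1}E => /(_ ltac:(lia)) H3.
  by rewrite E plus_INR; lra.
- set M := N./2 in E; case: (posnP M) => HM.
    by rewrite E HM /psi /= /Lam /=; lra.
  have H1 := @psi_sub_le M M.+1 (leqnSn _).
  have H2 := logfact_central_odd M.
  have := IH M.+1; rewrite {1}E => /(_ ltac:(lia)) H3.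
  by rewrite E plus_INR; lra.
Qed.

(** * Kernels from dilated partial sums, and Abel summation *)

Definition lin (c : seq (nat * Z)) (F : nat -> R) : R :=
  foldr (fun jc acc => IZR jc.2 * F jc.1 + acc) 0 c.

Definition Gker (phi : nat -> Z) c (m : nat) : R :=
  lin c (fun j => sum1 (fun k => IZR (phi k) / INR k) (m %/ j)%N).

Definition Tker (phi : nat -> Z) c (N : nat) : R :=
  lin c (fun j => sum1 (fun k => IZR (phi k) / INR k * ln (INR k)) (N %/ j)%N).

(** Since floor(floor(N/j)/n) = floor(floor(N/n)/j), a dilation by j passes to the argument of the
    kernel. For n > N/j the inner sum is empty, so all dilations share the range n <= N. *)
Lemma Tker_Lam phi c N :
  (forall n m, phi (n * m)%N = (phi n * phi m)%Z) ->
  all (fun jc => 0 < jc.1)%N c ->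
  Tker phi c N =
  sum1 (fun n => IZR (phi n) / INR n * Lam n * Gker phi c (N %/ n)%N) N.
Proof.
move=> Hphi; elim: c => [|[j a] c IH] /=.
  by move=> _; rewrite sum1_zero // => n _; rewrite /Gker /=; lra.
case/andP=> Hj Hc; rewrite {1}/Tker /= -/(Tker phi c N) IH // mult_log_convolution; last first.
  move=> n m Hn Hm; rewrite Hphi mult_IZR mult_INR.
  by have := INR_gt0 Hn; have := INR_gt0 Hm; move=> *; field; lra.
rewrite -(@sum1_extend _ (N %/ j)%N N); [|exact: leq_div|]; last first.
  move=> k Hk; rewrite (@divn_small (N %/ j)%N) /=; [lra|lia].
rewrite -sum1_scal -sum1_plus; apply: sum1_ext => n Hn.
by rewrite /Gker /= -/(Gker phi c (N %/ n)%N) divnAC; ring.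
Qed.

(** The coefficients eta(k) = sum_(j | k) j c_j phi(k/j) that make the kernel a single sum of
    eta(k)/k. They are integers, and periodic when phi is, so a bound on their partial sums is a
    finite exact computation. *)
Definition eta (phi : nat -> Z) (c : seq (nat * Z)) (k : nat) : Z :=
  foldr (fun jc acc =>
    (if (jc.1 %| k)%N then Z.of_nat jc.1 * jc.2 * phi (k %/ jc.1)%N else 0) + acc)%Z 0%Z c.

Lemma Gker_eta phi c m :
  all (fun jc => 0 < jc.1)%N c ->
  Gker phi c m = sum1 (fun k => IZR (eta phi c k) / INR k) m.
Proof.
elim: c => [|[j a] c IH] /=.
  by move=> _; rewrite sum1_zero // => n _; rewrite /=; lra.
case/andP=> Hj Hc; rewrite {1}/Gker /= -/(Gker phi c m) IH // -sum1_dvd // -sum1_scal -sum1_plus.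
apply: sum1_ext => k Hk; rewrite plus_IZR; case: ifP => [/dvdnP[i Ei]|_]; last lra.
rewrite Ei mulnK // !mult_IZR -INR_IZR_INZ mult_INR.
have Hi : (0 < i)%N by move: Hk; rewrite Ei; case: (i).
have := INR_gt0 Hj; have := INR_gt0 Hi; move=> *; field; lra.
Qed.

Definition zsum (f : nat -> Z) (n : nat) : Z := foldl (fun acc k => acc + f k)%Z 0%Z (iota 1 n).

Lemma zsumS f n : zsum f n.+1 = (zsum f n + f n.+1)%Z.
Proof. by rewrite /zsum -{1}[n.+1]addn1 iotaD foldl_cat /= add1n. Qed.

(* Abel summation, with the partial sums recentred at their value at m *)
Lemma dirichlet_test (f : nat -> Z) (w : nat -> R) (W : R) m0 m m' :
  (forall k l, IZR (zsum f k) - IZR (zsum f l) <= W) ->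
  (forall k, (m0 <= k)%N -> 0 <= w k.+1 <= w k) ->
  (m0 <= m)%N -> (m <= m')%N ->
  Rabs (sum1 (fun k => IZR (f k) * w k) m' - sum1 (fun k => IZR (f k) * w k) m)
    <= W * w m.+1.
Proof.
move=> HW Hw Hm0 Hmm'.
set S := sum1 _; set P := fun k => IZR (zsum f k).
have HS : forall k, S k.+1 = S k + IZR (f k.+1) * w k.+1 by [].
have HP : forall k, P k.+1 = P k + IZR (f k.+1) by move=> k; rewrite /P zsumS plus_IZR.
have Hinv : Rabs (S m' - S m - (P m' - P m) * w m'.+1) <= W * (w m.+1 - w m'.+1).
  elim: m' Hmm' => [|n IH] Hn.
    have -> : m = 0%N by lia.
    by rewrite -[X in Rabs X]/(S 0%N - S 0%N - (P 0%N - P 0%N) * w 1%N) !Rminus_diag Rmult_0_l Rminus_0_r Rmult_0_r Rabs_R0; lra.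
  case: (eqVneq m n.+1) => [->|Hne].
    by rewrite !Rminus_diag Rmult_0_l Rminus_0_r Rmult_0_r Rabs_R0; lra.
  have {}IH := IH ltac:(lia).
  have [Hw0 Hw1] := Hw n.+1 ltac:(lia).
  have -> : S n.+1 - S m - (P n.+1 - P m) * w n.+2 =
     (S n - S m - (P n - P m) * w n.+1) + (P n.+1 - P m) * (w n.+1 - w n.+2).
    by rewrite HS !HP; ring.
  apply: Rle_trans (Rabs_triang _ _) _; rewrite Rabs_mult (Rabs_pos_eq (w n.+1 - w n.+2)); last lra.
  have : Rabs (P n.+1 - P m) <= W by apply: Rabs_le; have := HW n.+1 m; have := HW m n.+1; rewrite -/(P n.+1) -/(P m); lra.
  nra.
have -> : S m' - S m = (S m' - S m - (P m' - P m) * w m'.+1) + (P m' - P m) * w m'.+1 by ring.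
have [Hw0 _] := Hw m' ltac:(lia).
apply: Rle_trans (Rabs_triang _ _) _; rewrite Rabs_mult (Rabs_pos_eq (w m'.+1)) //.
have : Rabs (P m' - P m) <= W by apply: Rabs_le; have := HW m' m; have := HW m m'; rewrite -/(P m') -/(P m); lra.
nra.
Qed.

(** * Limits and logarithmic sums *)

Lemma zsum_modn f q k :
  (forall k, (0 < k)%N -> f (k + q)%N = f k) -> zsum f q = 0%Z ->
  zsum f k = zsum f (k %% q)%N.
Proof.
move=> Hf Hq.
have Hper : forall i, zsum f (i + q)%N = zsum f i.
  by elim=> [|i IH]; rewrite ?add0n // addSn !zsumS IH -addSn Hf.
rewrite {1}(divn_eq k q); elim: (k %/ q)%N => [|i IH]; first by rewrite mul0n.
by rewrite mulSn -addnA addnC Hper.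
Qed.

Lemma zsum_oscillation f q (lo hi : Z) k l :
  (0 < q)%N -> (forall k, (0 < k)%N -> f (k + q)%N = f k) -> zsum f q = 0%Z ->
  all (fun k => (lo <=? zsum f k) && (zsum f k <=? hi))%Z (iota 0 q) ->
  IZR (zsum f k) - IZR (zsum f l) <= IZR (hi - lo).
Proof.
move=> Hq Hf H0 /allP Hall.
have Hb : forall i, (lo <= zsum f i <= hi)%Z.
  move=> i; rewrite (zsum_modn _ Hf H0).
  have := Hall (i %% q)%N; rewrite mem_iota /= add0n ltn_mod Hq => /(_ isT) /andP[/Z.leb_le ? /Z.leb_le ?].
  by split.
by rewrite -minus_IZR; apply: IZR_le; have := Hb k; have := Hb l; lia.
Qed.

Lemma eta_periodic phi c p q k :
  (forall k, phi (k + p)%N = phi k) ->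
  all (fun jc => (0 < jc.1) && (jc.1 * p %| q))%N c ->
  eta phi c (k + q)%N = eta phi c k.
Proof.
move=> Hphi; have Hp : forall i a, phi (i + a * p)%N = phi i.
  by move=> i; elim=> [|a IH]; rewrite ?mul0n ?addn0 // mulSnr addnA Hphi.
elim: c => //= -[j a] c IH /= /andP[/andP[Hj /dvdnP[b Eb]] Hc].
have Eq : q = (b * p * j)%N by rewrite Eb; lia.
by rewrite IH // {1 2}Eq dvdn_addl ?dvdn_mull // divnDr ?dvdn_mull // mulnK // Hp.
Qed.

Lemma cauchy_rate_limit (u : nat -> R) W :
  (forall m m', (m <= m')%N -> Rabs (u m' - u m) <= W / INR m.+1) ->
  exists l, Un_cv u l.
Proof.
move=> Hu; have [] := @Rcomplete.R_complete u; last by move=> l Hl; exists l.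
move=> eps Heps.
have [n Hn] := INR_unbounded ((2 * Rabs W + 1) / eps).
exists n => p q Hp Hq; rewrite /R_dist.
have Hb : forall p, (n <= p)%coq_nat -> Rabs (u p - u n) < eps / 2.
  move=> {p q Hp Hq} p Hp; apply: Rle_lt_trans (Hu n p _) _; first by apply/leP.
  have Hn1 : 0 < INR n.+1 by apply: INR_gt0.
  apply: (Rmult_lt_reg_r (INR n.+1)) => //.
  have -> : W / INR n.+1 * INR n.+1 = W by field; lra.
  have : 2 * Rabs W + 1 < eps * INR n.
    by have := Rmult_lt_compat_l _ _ _ Heps Hn; have -> : eps * ((2 * Rabs W + 1) / eps) = 2 * Rabs W + 1 by field; lra.
  by rewrite S_INR; have := Rle_abs W; nra.
have := Hb _ Hp; have := Hb _ Hq; move/Rabs_def2=> ? /Rabs_def2 ?.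
by apply: Rabs_def1; lra.
Qed.

Lemma Un_cv_dist_le (u : nat -> R) l m B :
  Un_cv u l -> (forall m', (m <= m')%N -> Rabs (u m' - u m) <= B) -> Rabs (l - u m) <= B.
Proof.
move=> Hl Hu; apply: Rle_plus_epsilon => eps Heps.
have [n Hn] := Hl _ Heps; have := Hn (maxn m n) ltac:(lia); rewrite /R_dist.
have := Hu (maxn m n) (leq_maxl _ _) => H1 H2.
have -> : l - u m = - (u (maxn m n) - l) + (u (maxn m n) - u m) by ring.
by apply: Rle_trans (Rabs_triang _ _) _; rewrite Rabs_Ropp; lra.
Qed.

Lemma Un_cv_lin c (F : nat -> nat -> R) (l : nat -> R) :
  (forall j, j \in map fst c -> Un_cv (F j) (l j)) ->
  Un_cv (fun m => lin c (fun j => F j m)) (lin c l).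
Proof.
elim: c => [|[j a] c IH] H /=.
  by move=> eps Heps; exists 0%N => n _; rewrite /R_dist /= Rminus_diag Rabs_R0.
apply: CV_plus; last by apply: IH => i Hi; apply: H; rewrite inE Hi orbT.
apply: CV_mult; last by apply: H; rewrite inE eqxx.
by move=> eps Heps; exists 0%N => n _; rewrite /R_dist /= Rminus_diag Rabs_R0.
Qed.

Lemma Un_cv_divn (u : nat -> R) l j :
  (0 < j)%N -> Un_cv u l -> Un_cv (fun m => u (m %/ j)%N) l.
Proof.
move=> Hj Hu eps Heps; have [n Hn] := Hu _ Heps.
by exists (n * j)%N => m /leP Hm; apply: Hn; apply/leP; rewrite leq_divRL.
Qed.

Lemma ln_minus x y : 0 < x -> 0 < y -> ln (x / y) = ln x - ln y.
Proof. by move=> Hx Hy; rewrite /Rdiv ln_mult; [rewrite ln_Rinv; [ring | lra] | lra | exact: Rinv_0_lt_compat]. Qed.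

Lemma ln_succ_bounds x : 0 < x -> 1 / (x + 1) <= ln (x + 1) - ln x <= 1 / x.
Proof.
move=> Hx; have Hl : forall y, 0 < y -> ln y <= y - 1.
  by move=> y Hy; have := exp_ineq1_le (ln y); rewrite exp_ln //; lra.
split.
  have := Hl (x / (x + 1)) ltac:(apply: Rdiv_lt_0_compat; lra).
  rewrite ln_minus; try lra; have -> : x / (x + 1) - 1 = - (1 / (x + 1)) by field; lra.
  lra.
have := Hl ((x + 1) / x) ltac:(apply: Rdiv_lt_0_compat; lra).
rewrite ln_minus; try lra; have -> : (x + 1) / x - 1 = 1 / x by field; lra.
lra.
Qed.

Definition harm (n : nat) : R := sum1 (fun k => 1 / INR k) n.

Lemma harm_sub_bounds a N : (0 < a)%N -> (a <= N)%N ->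
  ln (INR N.+1) - ln (INR a.+1) <= harm N - harm a <= ln (INR N) - ln (INR a).
Proof.
move=> Ha; elim: N => [|N IH] HN; first lia.
case: (eqVneq a N.+1) => [->|Hne]; first lra.
have := IH ltac:(lia); have -> : harm N.+1 = harm N + 1 / INR N.+1 by [].
have HN0 : 0 < INR N by apply: INR_gt0; lia.
have HN1 : 0 < INR N.+1 by apply: INR_gt0.
have := ln_succ_bounds HN0; have := ln_succ_bounds HN1; rewrite -!S_INR.
lra.
Qed.

Lemma divn_real_bounds N j : (0 < j)%N -> (j <= N)%N ->
  [/\ (0 < N %/ j)%N, INR (N %/ j)%N * INR j <= INR N & INR N < (INR (N %/ j)%N + 1) * INR j].
Proof.
move=> Hj HjN; split; first by rewrite divn_gt0.
  by rewrite -mult_INR; apply/le_INR/leP/leq_divM.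
by rewrite -S_INR -mult_INR; apply/lt_INR/ltP; exact: ltn_ceil.
Qed.

Lemma harm_divn_bound N j : (0 < j)%N -> (j <= N)%N ->
  Rabs ((harm (N %/ j)%N - harm N) - - ln (INR j)) <= 1 / INR (N %/ j)%N.
Proof.
move=> Hj HjN; have [Ha H1 H2] := divn_real_bounds Hj HjN.
set a := (N %/ j)%N in Ha H1 H2 *.
have := @harm_sub_bounds a N Ha (leq_div _ _).
have Hj0 := INR_gt0 Hj; have Ha0 := INR_gt0 Ha; have Hj1 := INR_ge1 Hj.
have [_ Hs] := ln_succ_bounds Ha0.
have HN0 : 0 < INR N by apply: INR_gt0; lia.
have HN1 : 0 < INR N + 1 by lra.
have := @ln_mult_le (INR N) 1 (INR a + 1) (INR j) HN0 Rlt_0_1 ltac:(lra) Hj0 ltac:(nra).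
have := @ln_mult_le (INR j) (INR a) (INR N + 1) 1 Hj0 Ha0 HN1 Rlt_0_1 ltac:(nra).
rewrite ln_1 !S_INR => ? ? ?.
have : 0 < 1 / INR a by apply: Rdiv_lt_0_compat; lra.
by move=> ?; apply: Rabs_le; lra.
Qed.

(** Only differences of harmonic sums are needed, because the coefficients of the kernel for f = 1
    sum to zero; Euler's constant cancels. *)
Lemma harm_divn_cv j : (0 < j)%N ->
  Un_cv (fun m => harm (m %/ j)%N - harm m) (- ln (INR j)).
Proof.
move=> Hj eps Heps; have [n Hn] := INR_unbounded (1 / eps).
exists (n.+1 * j)%N => m /leP Hm; rewrite /R_dist.
apply: Rle_lt_trans (@harm_divn_bound m j Hj _) _; first by nia.
have Hnm : (n.+1 <= m %/ j)%N by rewrite leq_divRL.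
have H1 : INR n.+1 <= INR (m %/ j)%N by apply/le_INR/leP.
have H2 : 0 < 1 / eps by apply: Rdiv_lt_0_compat; lra.
rewrite S_INR in H1.
apply: (Rmult_lt_reg_r (INR (m %/ j)%N)); first lra.
have -> : 1 / INR (m %/ j)%N * INR (m %/ j)%N = 1 by field; lra.
have : eps * (1 / eps) < eps * INR (m %/ j)%N by apply: Rmult_lt_compat_l; lra.
by have -> : eps * (1 / eps) = 1 by field; lra.
Qed.

Lemma lin_plus c F F' : lin c (fun j => F j + F' j) = lin c F + lin c F'.
Proof. by elim: c => [|[j a] c IH] /=; [lra | rewrite IH; ring]. Qed.

Lemma lin_const c x : lin c (fun=> x) = IZR (foldr (fun jc s => jc.2 + s)%Z 0%Z c) * x.
Proof. by elim: c => [|[j a] c IH] /=; [lra | rewrite IH plus_IZR; ring]. Qed.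

(* (ln t)^2 / 2 is a primitive of ln t / t, which decreases for t >= e. *)
Lemma ln_sq_succ_bounds x : 3 <= x ->
  ln (x + 1) / (x + 1) <= (ln (x + 1))² / 2 - (ln x)² / 2 <= ln x / x.
Proof.
move=> Hx.
have He : exp 1 <= 3 by exact: exp_le_3.
have Hl : 1 <= ln x by rewrite -(ln_exp 1); apply: ln_le_mono; [exact: exp_pos | lra].
have Hmono : forall u v, x <= u -> u <= v -> ln v / v <= ln u / u.
  move=> u v Hu Huv; have Hlu : 1 <= ln u by apply: Rle_trans Hl _; apply: ln_le_mono; lra.
  (* Together with 1 <= ln u this gives ln v <= ln u + ln u (v/u - 1), that is, the decrease of ln t
     / t beyond e. *)
  have Hq : ln v - ln u <= v / u - 1.
    rewrite -ln_minus; try lra.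
    by have := exp_ineq1_le (ln (v / u)); rewrite exp_ln; [lra | apply: Rdiv_lt_0_compat; lra].
  have Hr : 1 <= v / u by apply: (Rmult_le_reg_r u); first lra; rewrite /Rdiv Rmult_assoc Rinv_l; lra.
  have Hln : ln v <= ln u * (v / u) by nra.
  apply: (Rmult_le_reg_r v); first lra.
  have -> : ln v / v * v = ln v by field; lra.
  have -> : ln u / u * v = ln u * (v / u) by field; lra.
  by [].
have [z [Hz1 Hz2]] : exists z, (ln (x + 1))² / 2 - (ln x)² / 2 = ln z / z /\ x <= z <= x + 1.
  have [t Ht|z [Hz1 Hz2]] := @MVT_cor2 (fun t => (ln t)² / 2) (fun t => ln t / t) x (x + 1) ltac:(lra).
    by apply/is_derive_Reals; rewrite /Rsqr; auto_derive; [lra | field; lra].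
  by exists z; rewrite Hz1; split; [ring | lra].
by rewrite Hz1; split; apply: Hmono; lra.
Qed.

Lemma ln_div_decr k : (3 <= k)%N -> 0 <= ln (INR k.+1) / INR k.+1 <= ln (INR k) / INR k.
Proof.
move=> Hk; have H3 : 3 <= INR k by rewrite (_ : 3 = INR 3); [apply/le_INR/leP | rewrite /=; lra].
have := ln_sq_succ_bounds H3; rewrite -S_INR => ?; split; last lra.
apply: Rle_mult_inv_pos; [apply: ln_ge0; apply: INR_ge1 | apply: INR_gt0] => //.
Qed.

Lemma ln_div_antitone m n : (3 <= m)%N -> (m <= n)%N -> ln (INR n) / INR n <= ln (INR m) / INR m.
Proof.
move=> Hm; elim: n => [|n IH] Hn; first lia.
case: (eqVneq m n.+1) => [->|Hne]; first lra.
have := IH ltac:(lia); have := @ln_div_decr n ltac:(lia); lra.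
Qed.

Definition logharm (n : nat) : R := sum1 (fun k => 1 / INR k * ln (INR k)) n.

Lemma logharm_sub_bounds a N : (3 <= a)%N -> (a <= N)%N ->
  (ln (INR N.+1))² / 2 - (ln (INR a.+1))² / 2 <= logharm N - logharm a
    <= (ln (INR N))² / 2 - (ln (INR a))² / 2.
Proof.
move=> Ha; elim: N => [|N IH] HN; first lia.
case: (eqVneq a N.+1) => [->|Hne]; first lra.
have {}IH := IH ltac:(lia).
have H3 : 3 <= INR N by rewrite (_ : 3 = INR 3); [apply/le_INR/leP; lia | rewrite /=; lra].
have := ln_sq_succ_bounds H3; have := @ln_sq_succ_bounds (INR N + 1) ltac:(lra).
rewrite -!S_INR; have -> : logharm N.+1 = logharm N + 1 / INR N.+1 * ln (INR N.+1) by [].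
have -> : 1 / INR N.+1 * ln (INR N.+1) = ln (INR N.+1) / INR N.+1.
  by field; have := @INR_gt0 N.+1 isT; lra.
lra.
Qed.

(** The main term is (log(N/j))^2/2 - (log N)^2/2. Comparison with the integral of log t / t, and
    rounding N/j down to an integer a, cost at most log a / a. *)
Lemma logharm_divn_bound N j : (0 < j)%N -> (3 <= N %/ j)%N ->
  Rabs ((logharm (N %/ j)%N - logharm N) - (- ln (INR N) * ln (INR j) + (ln (INR j))² / 2))
   <= ln (INR (N %/ j)%N) / INR (N %/ j)%N.
Proof.
move=> Hj Ha3; have HjN : (j <= N)%N by rewrite -divn_gt0 //; lia.
have [Ha H1 H2] := divn_real_bounds Hj HjN.
set a := (N %/ j)%N in Ha Ha3 H1 H2 *.
have := @logharm_sub_bounds a N Ha3 (leq_div _ _).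
have Hj0 := INR_gt0 Hj; have Ha0 := INR_gt0 Ha; have Hj1 := INR_ge1 Hj.
have H3 : 3 <= INR a by rewrite (_ : 3 = INR 3); [apply/le_INR/leP | rewrite /=; lra].
have [_ Hs] := ln_sq_succ_bounds H3.
have HN0 : 0 < INR N by apply: INR_gt0; lia.
set t := INR N / INR j.
have Ht : INR a <= t by apply: (Rmult_le_reg_r (INR j)) => //; rewrite /t (_ : INR N / INR j * INR j = INR N); [lra | field; lra].
have Ht' : t <= INR a + 1 by apply: (Rmult_le_reg_r (INR j)) => //; rewrite /t (_ : INR N / INR j * INR j = INR N); [lra | field; lra].
have Elt : ln t = ln (INR N) - ln (INR j) by rewrite ln_minus.
have HN : ln (INR N) <= ln (INR N.+1) by apply: ln_le_mono => //; rewrite S_INR; lra.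
have HN' : 0 <= ln (INR N) by apply/ln_ge0/INR_ge1; lia.
have Hla : 0 <= ln (INR a) by apply/ln_ge0; lra.
have Hl1 : ln (INR a) <= ln t by apply: ln_le_mono; lra.
have Hl2 : ln t <= ln (INR a + 1) by apply: ln_le_mono; lra.
have Hsq : forall u v, 0 <= u -> u <= v -> u² <= v² by move=> u v ? ?; apply: Rsqr_incr_1; lra.
have Q1 := Hsq _ _ HN' HN; have Q2 := Hsq _ _ Hla Hl1; have Q3 := Hsq _ _ (Rle_trans _ _ _ Hla Hl1) Hl2.
have Et : (ln t)² = (ln (INR N))² - 2 * (ln (INR N) * ln (INR j)) + (ln (INR j))² by rewrite Elt /Rsqr; ring.
rewrite !S_INR in Q1 * => Hb.
by apply: Rabs_le; split; lra.
Qed.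

(** * The kernel inequality *)

Definition one_char : nat -> Z := fun=> 1%Z.

(* Heights are in thousandths; kernel coefficients below are in units of 10^-4. *)
Definition step_sum (kap : seq (nat * Z)) (m : nat) : R :=
  lin kap (fun k => if (k <= m)%N then 1 else 0).

Definition nonneg_steps (kap : seq (nat * Z)) : bool :=
  all (fun ka => (0 < ka.1)%N && (0 <=? ka.2)%Z) kap.

(** As k <= N/n is equivalent to n <= N/k, a step of height a at k contributes a psi(N/k), to which
    Chebyshev's bound applies. *)
Lemma sum_Lam_step_sum kap N : nonneg_steps kap -> (0 < N)%N ->
  sum1 (fun n => Lam n * step_sum kap (N %/ n)%N) N
    <= INR N * (2 * ln 2 * lin kap (fun k => / INR k)).
Proof.
move=> + HN; rewrite /step_sum; elim: kap => [|[k a] kap IH] /=.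
  by move=> _; rewrite sum1_zero => [|n _]; lra.
case/andP=> /andP[Hk /Z.leb_le Ha] {}/IH IH.
have -> : sum1 (fun n => Lam n * (IZR a * (if (k <= N %/ n)%N then 1 else 0) +
     lin kap (fun k => if (k <= N %/ n)%N then 1 else 0))) N = IZR a * psi (N %/ k)%N +
   sum1 (fun n => Lam n * lin kap (fun k => if (k <= N %/ n)%N then 1 else 0)) N.
  rewrite /psi (@sum1_ext Lam (fun n => if (n <= N %/ k)%N then Lam n else 0)); last first.
    by move=> n Hn; case: ifP => //; lia.
  rewrite -(@sum1_extend _ (N %/ k)%N N) ?leq_div //; last first.
    by move=> n Hn; case: ifP => //; lia.
  rewrite -sum1_scal -sum1_plus; apply: sum1_ext => n Hn.
  rewrite !leq_divRL ?[(n * k)%N]mulnC; [|lia|lia].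
  by case: ifP => _; ring.
have Ha0 : 0 <= IZR a by apply: IZR_le.
have Hk0 := INR_gt0 Hk; have HN0 := INR_gt0 HN.
have : psi (N %/ k)%N <= 2 * ln 2 * (INR N * / INR k).
  apply: Rle_trans (psi_le _) _; apply: Rmult_le_compat_l.
    by have := @ln_ge0 2; lra.
  apply: (Rmult_le_reg_r (INR k)) => //; rewrite Rmult_assoc Rinv_l; last lra.
  by rewrite Rmult_1_r -mult_INR; apply/le_INR/leP/leq_divM.
move/(Rmult_le_compat_l _ _ _ Ha0) => ?.
have -> : INR N * (2 * ln 2 * (IZR a * / INR k + lin kap (fun k => / INR k))) =
  IZR a * (2 * ln 2 * (INR N * / INR k)) + INR N * (2 * ln 2 * lin kap (fun k => / INR k)) by ring.
lra.
Qed.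

(** S_0 + s S_chi. The parameter s will be 1 or -1, so that one estimate serves both residue
    classes. *)
Definition twisted_mertens (phi : nat -> Z) (s : R) (N : nat) : R :=
  sum1 (fun n => Lam n * (1 + s * IZR (phi n)) / INR n) N.

(** The n-th term of the difference is Lambda(n)/n times (1 - G_0/theta) + s phi(n)(1 - G_1/g), with
    kernels taken at m = floor(N/n). As |s phi(n)| <= 1 and N/n <= m+1, N times this term is at most
    Lambda(n) times the hypothesis at m, so one staircase controls both kernels and every s. *)
Lemma twisted_mertens_kernel phi c0 c1 kap theta g s N :
  (forall n m, phi (n * m)%N = (phi n * phi m)%Z) ->
  (forall n, Rabs (IZR (phi n)) <= 1) -> Rabs s <= 1 ->
  all (fun jc => 0 < jc.1)%N c0 -> all (fun jc => 0 < jc.1)%N c1 ->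
  nonneg_steps kap -> (0 < N)%N -> 0 < theta -> 0 < g ->
  (forall m, (0 < m)%N ->
     INR m.+1 * (Rabs (1 - Gker one_char c0 m / theta) + Rabs (1 - Gker phi c1 m / g))
       <= step_sum kap m / 1000) ->
  Rabs (twisted_mertens phi s N - (Tker one_char c0 N / theta + s * (Tker phi c1 N / g)))
    <= 2 * ln 2 * (lin kap (fun k => / INR k) / 1000).
Proof.
move=> Hphi Hphi1 Hs Hc0 Hc1 Hkap HN Hth Hg Hpt.
have HN0 := INR_gt0 HN.
rewrite (@Tker_Lam one_char) // (@Tker_Lam phi) // /twisted_mertens.
have -> : forall A B C, A - (B / theta + s * (C / g)) = A - (/ theta * B + (s / g) * C).
  by move=> A B C; field; lra.
rewrite -!sum1_scal -sum1_plus -sum1_minus.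
apply: Rle_trans (sum1_abs _ _) _.
apply: (Rmult_le_reg_l (INR N)) => //; rewrite -sum1_scal.
apply: Rle_trans (_ : sum1 (fun n => / 1000 * (Lam n * step_sum kap (N %/ n)%N)) N <= _); last first.
  rewrite sum1_scal; have H := sum_Lam_step_sum Hkap HN.
  rewrite (_ : INR N * _ = / 1000 * (INR N * (2 * ln 2 * lin kap (fun k => / INR k)))); last by field.
  by apply: Rmult_le_compat_l => //; lra.
apply: sum1_le => n Hn; have Hn0 : 0 < INR n by apply: INR_gt0; lia.
have HL := Lam_ge0 n.
set G0 := Gker one_char _ _; set G1 := Gker phi _ _.
have -> : Lam n * (1 + s * IZR (phi n)) / INR n -
  (/ theta * (IZR (one_char n) / INR n * Lam n * G0) +
   s / g * (IZR (phi n) / INR n * Lam n * G1)) =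
  Lam n * / INR n * ((1 - G0 / theta) + s * IZR (phi n) * (1 - G1 / g)).
  by rewrite /one_char; field; lra.
have Hin : 0 < / INR n by apply: Rinv_0_lt_compat.
rewrite Rabs_mult Rabs_pos_eq; last by apply: Rmult_le_pos; lra.
have Hm : (0 < N %/ n)%N by rewrite divn_gt0; lia.
have H1 := Hpt _ Hm.
have H2 : Rabs (1 - G0 / theta + s * IZR (phi n) * (1 - G1 / g)) <=
   Rabs (1 - G0 / theta) + Rabs (1 - G1 / g).
  apply: Rle_trans (Rabs_triang _ _) _; rewrite !Rabs_mult.
  have := Hphi1 n; have := Rabs_pos (IZR (phi n)); have := Rabs_pos s; have := Rabs_pos (1 - G1 / g).
  move=> *; have ? : Rabs s * Rabs (IZR (phi n)) <= 1 by nra.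
  have ? : 0 <= Rabs s * Rabs (IZR (phi n)) by nra.
  nra.
have H3 : INR N * / INR n <= INR (N %/ n).+1.
  apply: (Rmult_le_reg_r (INR n)) => //; rewrite Rmult_assoc Rinv_l; last lra.
  by rewrite Rmult_1_r -mult_INR; apply/le_INR/leP/ltnW/ltn_ceil; lia.
have HA := Rabs_pos (1 - G0 / theta); have HB := Rabs_pos (1 - G1 / g).
apply: Rle_trans (_ : Lam n * ((INR N * / INR n) * (Rabs (1 - G0 / theta) + Rabs (1 - G1 / g))) <= _).
  have -> : INR N * (Lam n * / INR n * Rabs (1 - G0 / theta + s * IZR (phi n) * (1 - G1 / g))) =
    Lam n * ((INR N * / INR n) * Rabs (1 - G0 / theta + s * IZR (phi n) * (1 - G1 / g))) by ring.
  by apply: Rmult_le_compat_l => //; apply: Rmult_le_compat_l => //; nra.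
rewrite (_ : / 1000 * _ = Lam n * (step_sum kap (N %/ n)%N / 1000)); last by field.
apply: Rmult_le_compat_l => //; apply: Rle_trans H1.
by apply: Rmult_le_compat_r; lra.
Qed.

(** * Explicit asymptotics of the logarithmic sums, and limits of the kernels *)

Definition absc (c : seq (nat * Z)) : seq (nat * Z) := map (fun jc => (jc.1, Z.abs jc.2)) c.

Lemma lin_abs_le c F B :
  (forall j, j \in map fst c -> Rabs (F j) <= B j) -> Rabs (lin c F) <= lin (absc c) B.
Proof.
elim: c => [|[j a] c IH] H /=; first by rewrite Rabs_R0; lra.
apply: Rle_trans (Rabs_triang _ _) _; apply: Rplus_le_compat; last first.
  by apply: IH => i Hi; apply: H; rewrite inE Hi orbT.
rewrite Rabs_mult abs_IZR; apply: Rmult_le_compat_l; first exact: Rabs_pos.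
by apply: H; rewrite inE eqxx.
Qed.

Lemma all_fst (P : pred nat) (c : seq (nat * Z)) j :
  all (fun jc => P jc.1) c -> j \in map fst c -> P j.
Proof. by rewrite -(all_map fst P) => /allP H /H. Qed.

Definition log_over (n : nat) : R := ln (INR n) / INR n.

Definition coef_sum (c : seq (nat * Z)) : Z := foldr (fun jc s => jc.2 + s)%Z 0%Z c.

(** [theta_of] and [log2_of] are the first derivative and half the second derivative at s = 0 of
    sum_j c_j j^(-s). *)
Definition theta_of (c : seq (nat * Z)) : R := lin c (fun j => - ln (INR j)).
Definition log2_of (c : seq (nat * Z)) : R := lin c (fun j => (ln (INR j))² / 2).

(** Because the coefficients sum to zero, [logharm N] may be subtracted from every term. This
    removes (log N)^2/2 and leaves an expression linear in log N. *)
Lemma Tker_one_asymptotic c N X :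
  coef_sum c = 0%Z -> all (fun jc => (0 < jc.1) && (3 <= X %/ jc.1))%N c -> (X <= N)%N ->
  Rabs (Tker one_char c N - (theta_of c * ln (INR N) + log2_of c))
    <= lin (absc c) (fun j => log_over (X %/ j)%N).
Proof.
move=> H0 Hc HX; rewrite /Tker.
have -> : lin c (fun j => sum1 (fun k => IZR (one_char k) / INR k * ln (INR k)) (N %/ j)%N) =
  lin c (fun j => logharm (N %/ j)%N - logharm N).
  have -> : lin c (fun j => logharm (N %/ j)%N - logharm N) =
    lin c (fun j => logharm (N %/ j)%N) + lin c (fun=> - logharm N) by rewrite -lin_plus.
  by rewrite lin_const -/(coef_sum c) H0 Rmult_0_l Rplus_0_r.
have -> : theta_of c * ln (INR N) + log2_of c =
   lin c (fun j => - ln (INR N) * ln (INR j) + (ln (INR j))² / 2).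
  rewrite lin_plus; congr (_ + _); rewrite /theta_of.
  by elim: (c) => [|[j a] c' IH] /=; [lra | rewrite Rmult_plus_distr_r IH; ring].
have -> : forall F F', lin c F - lin c F' = lin c (fun j => F j - F' j).
  by move=> F F'; elim: (c) => [|[j a] c' IH] /=; [lra | rewrite -IH; ring].
apply: lin_abs_le => j Hj.
have /andP[Hj0 Hj3] := @all_fst (fun j => (0 < j) && (3 <= X %/ j))%N c j Hc Hj.
have Hd : (X %/ j <= N %/ j)%N by exact: leq_div2r.
apply: Rle_trans (logharm_divn_bound Hj0 _) _; first by apply: leq_trans Hd.
exact: ln_div_antitone.
Qed.

Definition Lsum (phi : nat -> Z) (n : nat) : R := sum1 (fun k => IZR (phi k) / INR k) n.
Definition Vsum (phi : nat -> Z) (n : nat) : R := sum1 (fun k => IZR (phi k) / INR k * ln (INR k)) n.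

Lemma Vsum_variation phi a M M' :
  (forall k l, IZR (zsum phi k) - IZR (zsum phi l) <= 1) ->
  (3 <= a)%N -> (a <= M)%N -> (a <= M')%N -> Rabs (Vsum phi M' - Vsum phi M) <= log_over a.
Proof.
move=> Hphi Ha.
wlog HMM : M M' / (M <= M')%N => [Hw|HM _].
  by case: (leqP M M') => [|/ltnW] H *; last rewrite Rabs_minus_sym; apply: Hw.
have E : forall n, Vsum phi n = sum1 (fun k => IZR (phi k) * (ln (INR k) / INR k)) n.
  move=> n; apply: sum1_ext => k Hk; have ? : 0 < INR k by apply: INR_gt0; lia.
  by field; lra.
rewrite !E; apply: Rle_trans (@dirichlet_test phi (fun k => ln (INR k) / INR k) 1 3 M M' Hphi _ _ HMM) _.
- by move=> k Hk; exact: ln_div_decr.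
- lia.
rewrite Rmult_1_l; apply: ln_div_antitone; lia.
Qed.

(** All the sums, cut at floor(N/j), are compared with the sum cut at X, which is computable, rather
    than with its limit. Both cuts are at least floor(X/j), so the Dirichlet test from there bounds
    the difference. *)
Lemma Tker_asymptotic phi c N X :
  (forall k l, IZR (zsum phi k) - IZR (zsum phi l) <= 1) ->
  all (fun jc => (0 < jc.1) && (3 <= X %/ jc.1))%N c -> (X <= N)%N ->
  Rabs (Tker phi c N - IZR (coef_sum c) * Vsum phi X)
    <= lin (absc c) (fun j => log_over (X %/ j)%N).
Proof.
move=> Hphi Hc HX; rewrite /Tker -lin_const.
have -> : forall F F', lin c F - lin c F' = lin c (fun j => F j - F' j).
  by move=> F F'; elim: (c) => [|[j a] c' IH] /=; [lra | rewrite -IH; ring].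
apply: lin_abs_le => j Hj.
have /andP[Hj0 Hj3] := @all_fst (fun j => (0 < j) && (3 <= X %/ j))%N c j Hc Hj.
by apply: (@Vsum_variation phi) => //; [exact: leq_div | exact: leq_div2r].
Qed.

Lemma inv_decr k : (1 <= k)%N -> 0 <= / INR k.+1 <= / INR k.
Proof.
move=> Hk; have H0 := INR_gt0 Hk; split; first by left; apply/Rinv_0_lt_compat/INR_gt0.
by apply: Rinv_le_contravar => //; rewrite S_INR; lra.
Qed.

Lemma inv_weight_tail f W m m' : 
  (forall k l, IZR (zsum f k) - IZR (zsum f l) <= W) -> (0 < m)%N -> (m <= m')%N ->
  Rabs (sum1 (fun k => IZR (f k) / INR k) m' - sum1 (fun k => IZR (f k) / INR k) m)
    <= W / INR m.+1.
Proof. by move=> HW Hm; apply: dirichlet_test; [exact: HW | exact: inv_decr |]. Qed.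

(** L is L(1,chi); the explicit rate is what allows it to be enclosed from finitely many terms. *)
Lemma Lsum_limit phi :
  (forall k l, IZR (zsum phi k) - IZR (zsum phi l) <= 1) ->
  exists2 L, Un_cv (Lsum phi) L & forall m, (0 < m)%N -> Rabs (L - Lsum phi m) <= / INR m.+1.
Proof.
move=> Hphi.
have Htail : forall m m', (0 < m)%N -> (m <= m')%N -> Rabs (Lsum phi m' - Lsum phi m) <= / INR m.+1.
  by move=> m m' Hm Hmm; have := @inv_weight_tail phi 1 m m' Hphi Hm Hmm; rewrite /Rdiv Rmult_1_l.
have [L HL] : exists L, Un_cv (fun n => Lsum phi n.+1) L.
  apply: (@cauchy_rate_limit _ 1) => m m' Hm; apply: Rle_trans (Htail _ _ _ _) _ => //.
  have := @inv_decr m.+1 isT; rewrite /Rdiv Rmult_1_l; lra.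
have HL' : Un_cv (Lsum phi) L.
  by move=> eps /HL[n Hn]; exists n.+1 => -[|k] Hk; [lia | apply: Hn; lia].
exists L => // m Hm; apply: Un_cv_dist_le HL' _ => m' Hm'; exact: Htail.
Qed.

(** Abel summation bounds the tail of sum eta(k)/k by W/(m+1), which the weight m+1 cancels exactly.
    The bound is uniform in m, so the staircase can stop rising. *)
Lemma Gker_tail phi c W g m :
  all (fun jc => 0 < jc.1)%N c ->
  (forall k l, IZR (zsum (eta phi c) k) - IZR (zsum (eta phi c) l) <= W) ->
  Un_cv (Gker phi c) g -> (0 < m)%N -> INR m.+1 * Rabs (g - Gker phi c m) <= W.
Proof.
move=> Hc HW Hg Hm; have H0 : 0 < INR m.+1 by apply: INR_gt0.
have : Rabs (g - Gker phi c m) <= W / INR m.+1.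
  apply: Un_cv_dist_le Hg _ => m' Hm'; rewrite !Gker_eta //; exact: inv_weight_tail.
move/(Rmult_le_compat_l _ _ _ (Rlt_le _ _ H0)).
by have -> : INR m.+1 * (W / INR m.+1) = W by field; lra.
Qed.

Lemma Gker_limit phi c L :
  all (fun jc => 0 < jc.1)%N c -> Un_cv (Lsum phi) L ->
  Un_cv (Gker phi c) (IZR (coef_sum c) * L).
Proof.
move=> Hc HL; rewrite -lin_const.
have := @Un_cv_lin c (fun j m => Lsum phi (m %/ j)%N) (fun=> L); apply=> j Hj.
by apply: Un_cv_divn HL; exact: (@all_fst (fun j => 0 < j)%N c j Hc Hj).
Qed.

Lemma Gker_one_limit c :
  all (fun jc => 0 < jc.1)%N c -> coef_sum c = 0%Z ->
  Un_cv (Gker one_char c) (theta_of c).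
Proof.
move=> Hc H0.
have Hcv : Un_cv (fun m => lin c (fun j => harm (m %/ j)%N - harm m)) (theta_of c).
  have := @Un_cv_lin c (fun j m => harm (m %/ j)%N - harm m) (fun j => - ln (INR j)).
  by apply=> j Hj; apply: harm_divn_cv; exact: (@all_fst (fun j => 0 < j)%N c j Hc Hj).
have E : forall m, Gker one_char c m = lin c (fun j => harm (m %/ j)%N - harm m).
  move=> m; have -> : lin c (fun j => harm (m %/ j)%N - harm m) =
    lin c (fun j => harm (m %/ j)%N) + lin c (fun=> - harm m) by rewrite -lin_plus.
  by rewrite lin_const -/(coef_sum c) H0 Rmult_0_l Rplus_0_r.
by move=> eps /Hcv[n Hn]; exists n => m Hm; rewrite E; apply: Hn.
Qed.

(** * Splitting into residue classes *)

Lemma INR_expn p r : INR (p ^ r)%N = INR p ^ r.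
Proof. by elim: r => [|r IH] //; rewrite expnS mult_INR IH. Qed.

Definition chi (d k : nat) : Z :=
  if (k %% d == 1)%N then 1%Z else if (k %% d == d.-1)%N then (-1)%Z else 0%Z.

Lemma chi_mod d k : chi d (k %% d)%N = chi d k.
Proof. by rewrite /chi modn_mod. Qed.

Lemma chi_mul d n m : d \in [:: 3; 4]%N -> chi d (n * m)%N = (chi d n * chi d m)%Z.
Proof.
move=> Hd; rewrite -chi_mod -modnMm -(chi_mod d n) -(chi_mod d m) chi_mod.
have := ltn_pmod n (_ : 0 < d)%N; have := ltn_pmod m (_ : 0 < d)%N.
move: (n %% d)%N (m %% d)%N Hd => a b; rewrite !inE => /orP[]/eqP-> /(_ isT) Hb /(_ isT) Ha.
  by case: a Ha => [|[|[|]]] //; case: b Hb => [|[|[|]]].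
by case: a Ha => [|[|[|[|]]]] //; case: b Hb => [|[|[|[|]]]].
Qed.

Lemma chi_abs d n : Rabs (IZR (chi d n)) <= 1.
Proof. by rewrite /chi; do 2?case: ifP => _; apply: Rabs_le; lra. Qed.

Lemma chi_periodic d k : chi d (k + d)%N = chi d k.
Proof. by rewrite /chi modnDr. Qed.

Lemma chi_partial_sums d k l : d \in [:: 3; 4]%N ->
  IZR (zsum (chi d) k) - IZR (zsum (chi d) l) <= 1.
Proof.
move=> Hd; have := @zsum_oscillation (chi d) d 0 1 k l; rewrite [IZR (1 - 0)]/=; apply.
- by move: Hd; rewrite !inE => /orP[]/eqP->.
- by move=> *; exact: chi_periodic.
- by move: Hd; rewrite !inE => /orP[]/eqP->.
- by move: Hd; rewrite !inE => /orP[]/eqP->.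
Qed.

Lemma chi_exp d p r : d \in [:: 3; 4]%N -> chi d (p ^ r)%N = Z.pow (chi d p) (Z.of_nat r).
Proof.
move=> Hd; elim: r => [|r IH]; first by move: Hd; rewrite !inE => /orP[]/eqP->.
by rewrite expnS chi_mul // IH Nat2Z.inj_succ Z.pow_succ_r //; lia.
Qed.

Lemma LambdaDA_prime_power d a p r : prime p -> (0 < r)%N ->
  LambdaDA d a (p ^ r)%N = if (p %% d == a %% d)%N then ln (INR p) else 0.
Proof. by move=> Pp Hr; rewrite /LambdaDA primesX // primes_prime. Qed.

Lemma LambdaDA_other d a n : (forall p r, prime p -> (0 < r)%N -> n <> (p ^ r)%N) ->
  LambdaDA d a n = 0.
Proof.
move=> H; rewrite /LambdaDA; case E: (primes n) => [|p [|q s]] //.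
by case: (primes1_eq E) => Pp [r Hr En]; case: (H p r).
Qed.

(* chi_d(n) = 1 while p = -1 (mod d) forces an even exponent. *)
Definition evens d n : R := if (chi d n =? 1)%Z then LambdaDA d d.-1 n else 0.
(** For d = 3 and d = 4, [pdiv d] is the only prime dividing d, namely 3 and 2. *)
Definition ramified d n : R := if (pdiv d %| n)%N then Lam n else 0.

Lemma prime_class d p : d \in [:: 3; 4]%N -> prime p ->
  [\/ (p %% d = 1)%N /\ p <> pdiv d, (p %% d = d.-1)%N /\ p <> pdiv d
    | [/\ (p %% d <> 1)%N, (p %% d <> d.-1)%N & p = pdiv d]].
Proof.
rewrite !inE => /orP[]/eqP-> Pp.
  rewrite [pdiv 3]/=; case: (eqVneq p 3%N) => [->|Hp]; first exact: Or33.
  have := @ltn_pmod p 3 isT; case E: (p %% 3)%N => [|[|[|]]] // _.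
  + by have : (3 %| p)%N; [rewrite /dvdn E | rewrite dvdn_prime2 // eq_sym (negbTE Hp)].
  + by apply: Or31; split=> //; apply/eqP.
  + by apply: Or32; split=> //; apply/eqP.
rewrite [pdiv 4]/=; case: (eqVneq p 2%N) => [->|Hp]; first exact: Or33.
have : odd p by case: (even_prime Pp) => // E; rewrite E in Hp.
rewrite -(@odd_mod p 4) //; have := @ltn_pmod p 4 isT; case E: (p %% 4)%N => [|[|[|[|]]]] // _ _.
+ by apply: Or31; split=> //; apply/eqP.
+ by apply: Or32; split=> //; apply/eqP.
Qed.

Lemma pdiv_class d : d \in [:: 3; 4]%N -> prime (pdiv d) /\ chi d (pdiv d) = 0%Z.
Proof. by rewrite !inE => /orP[]/eqP->. Qed.

Lemma ramified_prime_power d p r : d \in [:: 3; 4]%N -> prime p -> (0 < r)%N ->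
  ramified d (p ^ r)%N = if p == pdiv d then ln (INR p) else 0.
Proof.
move=> Hd Pp Hr; have [Pq _] := pdiv_class Hd.
by rewrite /ramified Euclid_dvdX // Hr andbT dvdn_prime2 // Lam_prime_power // eq_sym.
Qed.

Lemma pow_neg1 r : ((-1) ^ Z.of_nat r = if odd r then -1 else 1)%Z.
Proof.
by elim: r => [|r IH] //; rewrite Nat2Z.inj_succ Z.pow_succ_r ?IH /=; [case: odd | lia].
Qed.

(** [LambdaDA] sorts n = p^r by the class of p, while chi sees the class of p^r. They disagree only
    for even powers of primes p = -1, where chi is 1, and [evens] moves these back; powers of the
    prime dividing d have chi = 0 and occur on both sides. *)
Lemma class_split d n : d \in [:: 3; 4]%N ->
  Lam n * (1 + IZR (chi d n)) = 2 * LambdaDA d 1 n + 2 * evens d n + ramified d n /\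
  Lam n * (1 - IZR (chi d n)) = 2 * LambdaDA d d.-1 n - 2 * evens d n + ramified d n.
Proof.
move=> Hd; case: LamP => [p r Pp Hr ->|Hn]; last first.
  rewrite /evens /ramified !LambdaDA_other //.
  case: LamP => [p r Pp Hr En|_]; first by case: (Hn p r).
  by split; do 2?case: ifP => _; lra.
rewrite ramified_prime_power // /evens !LambdaDA_prime_power // chi_exp //.
have Hd1 : (1 %% d = 1)%N by move: Hd; rewrite !inE => /orP[]/eqP->.
have Hd2 : (d.-1 %% d = d.-1)%N by move: Hd; rewrite !inE => /orP[]/eqP->.
have Hd3 : (d.-1 == 1)%N = false by move: Hd; rewrite !inE => /orP[]/eqP->.
rewrite Hd1 Hd2 /chi; case: (prime_class Hd Pp) => [[E /eqP/negbTE Ep]|[E /eqP/negbTE Ep]|[/eqP/negbTE E1 /eqP/negbTE E2 Ep]].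
- by rewrite E Ep eqxx eq_sym Hd3 Z.pow_1_l; [rewrite /=; split; lra | lia].
- by rewrite E Ep Hd3 eqxx; rewrite pow_neg1; case: odd; rewrite /=; split; lra.
- rewrite E1 E2 Ep eqxx Z.pow_0_l; [rewrite /=; split; lra | lia].
Qed.

Definition Hsum (d a N : nat) : R := sum1 (fun n => LambdaDA d a n / INR n) N.
Definition Esum (d N : nat) : R := sum1 (fun n => evens d n / INR n) N.
Definition Zsum (d N : nat) : R := sum1 (fun n => ramified d n / INR n) N.

Lemma Hsum_twisted d N : d \in [:: 3; 4]%N ->
  2 * Hsum d 1 N = twisted_mertens (chi d) 1 N - 2 * Esum d N - Zsum d N /\
  2 * Hsum d d.-1 N = twisted_mertens (chi d) (-1) N + 2 * Esum d N - Zsum d N.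
Proof.
move=> Hd; rewrite /Hsum /Esum /Zsum /twisted_mertens -!sum1_scal; split.
  rewrite -!sum1_minus; apply: sum1_ext => n _; have [E _] := class_split n Hd.
  by rewrite Rmult_1_l E /Rdiv; ring.
rewrite -sum1_plus -sum1_minus; apply: sum1_ext => n _; have [_ E] := class_split n Hd.
have -> : 1 + -1 * IZR (chi d n) = 1 - IZR (chi d n) by ring.
by rewrite E /Rdiv; ring.
Qed.

Lemma LambdaDA_ge0 d a n : 0 <= LambdaDA d a n.
Proof.
have := Lam_ge0 n; rewrite /LambdaDA /Lam; case: (primes n) => [|p [|q s]]; try lra.
by case: ifP => _; lra.
Qed.

Lemma LambdaDA_le_Lam d a n : LambdaDA d a n <= Lam n.
Proof.
have := Lam_ge0 n; rewrite /LambdaDA /Lam; case: (primes n) => [|p [|q s]]; try lra.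
by case: ifP => _; lra.
Qed.

Lemma sum_indicator_le a c N : 0 <= c -> sum1 (fun n => if n == a then c else 0) N <= c.
Proof.
move=> Hc; case: (boolP (0 < a <= N)%N) => Ha.
  by rewrite (sum1_single Ha) ?eqxx; [lra | move=> k _ /negbTE->].
rewrite sum1_zero // => k Hk; case: eqP => // Ek; rewrite -Ek in Ha.
by rewrite Hk in Ha.
Qed.

(** Each n in the support of f chooses an i with h(i) = n, so different n choose different i;
    exchanging the sums over the pairs (n, i) with n = h(i) counts each g(i) at most once. *)
Lemma sum_reindex_le f (h : nat -> nat) g N :
  (forall i, 0 <= g i) ->
  (forall n, (0 < n <= N)%N -> f n <> 0 -> exists2 i, (0 < i <= N)%N & n = h i /\ f n <= g i) ->
  sum1 f N <= sum1 g N.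
Proof.
move=> Hg Hf.
apply: Rle_trans (_ : sum1 (fun n => sum1 (fun i => if n == h i then g i else 0) N) N <= _).
  apply: sum1_le => n Hn; case: (Req_dec (f n) 0) => [->|H0].
    by apply: sum1_ge0 => i _; case: ifP => _; [apply: Hg | lra].
  have [i Hi [En Hle]] := Hf n Hn H0.
  apply: Rle_trans Hle _; rewrite -(_ : sum1 (fun k => if k == i then g i else 0) N = g i).
    apply: sum1_le => k _; case: eqP => [->|_]; first by rewrite En eqxx; lra.
    by case: ifP => _; [apply: Hg | lra].
  by rewrite (sum1_single Hi) ?eqxx // => k _ /negbTE->.
rewrite sum1_swap; apply: sum1_le => i _; exact: sum_indicator_le.
Qed.

(** With q the prime dividing d, the sum runs over powers of q and is dominated by the geometric
    series of log q / q^r. Reindexing by r <= N is enough since r < q^r. *)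
Lemma ramified_sum_le d N : d \in [:: 3; 4]%N ->
  Zsum d N <= ln (INR (pdiv d)) / (INR (pdiv d) - 1).
Proof.
move=> Hd; have [Pq _] := pdiv_class Hd; set q := pdiv d in Pq *.
have Hq0 : 0 < INR q - 1.
  have : INR 2 <= INR q by apply/le_INR/leP/prime_gt1.
  by rewrite /=; lra.
have Hl : 0 <= ln (INR q) by apply: ln_ge0; lra.
have Hpow : forall r, 0 < INR q ^ r by move=> r; apply: pow_lt; lra.
apply: Rle_trans (_ : sum1 (fun r => ln (INR q) / INR q ^ r) N <= _).
  apply: (@sum_reindex_le _ (fun r => q ^ r)%N).
    by move=> r; apply: Rle_mult_inv_pos.
  move=> n Hn; rewrite /ramified -/q.
  case: ifP => [Hqn|]; last by rewrite /Rdiv Rmult_0_l.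
  case: LamP => [p r Pp Hr En|_]; last by rewrite /Rdiv Rmult_0_l.
  move=> _; exists r.
    by rewrite Hr; apply: leq_trans (_ : n <= N)%N; [rewrite En; apply/ltnW/ltn_expl/prime_gt1 | lia].
  have -> : q = p by apply/eqP; rewrite -dvdn_prime2 //; move: Hqn; rewrite En Euclid_dvdX // => /andP[].
  by split=> //; rewrite En INR_expn; lra.
have -> : sum1 (fun r => ln (INR q) / INR q ^ r) N = ln (INR q) / (INR q - 1) * (1 - / INR q ^ N).
  elim: N => [|N IH]; first by rewrite /=; field; lra.
  rewrite [LHS]/= -/(sum1 _ N) IH -tech_pow_Rmult; have := Hpow N; move=> ?; field; lra.
have := Rinv_0_lt_compat _ (Hpow N).
have : 0 <= ln (INR q) / (INR q - 1) by apply: Rle_mult_inv_pos.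
nra.
Qed.

(** A telescoping integral comparison: -(log x + 1)/x is a primitive of log x / x^2. *)
Lemma log_square_tail x : 3 <= x ->
  ln (x + 1) / (x + 1)² <= (ln x + 1) / x - (ln (x + 1) + 1) / (x + 1).
Proof.
move=> Hx; have [Hlo _] := @ln_succ_bounds x ltac:(lra); have [_ Hhi] := @ln_succ_bounds x ltac:(lra).
have H : ln (x + 1) / (x + 1) <= ln x / x by have := ln_sq_succ_bounds Hx; lra.
have E1 : (ln x + 1) / x - (ln (x + 1) + 1) / (x + 1) =
  (ln x + 1 - x * (ln (x + 1) - ln x)) / (x * (x + 1)) by field; lra.
have E2 : ln (x + 1) / (x + 1)² = (x * (ln (x + 1) / (x + 1))) / (x * (x + 1)).
  by rewrite /Rsqr; field; lra.
rewrite E1 E2; apply: Rmult_le_compat_r.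
  by left; apply: Rinv_0_lt_compat; nra.
have : x * (ln (x + 1) / (x + 1)) <= x * (ln x / x) by apply: Rmult_le_compat_l; lra.
have -> : x * (ln x / x) = ln x by field; lra.
have : x * (ln (x + 1) - ln x) <= x * (1 / x) by apply: Rmult_le_compat_l; lra.
have -> : x * (1 / x) = 1 by field; lra.
lra.
Qed.

Definition squares_sum (d X : nat) : R := sum1 (fun s => LambdaDA d d.-1 s / (INR s)²) X.

Lemma squares_sum_tail d X N : (3 <= X)%N -> (X <= N)%N ->
  squares_sum d N <= squares_sum d X + (ln (INR X) + 1) / INR X - (ln (INR N) + 1) / INR N.
Proof.
move=> HX; elim: N => [|N IH] HN; first lia.
case: (eqVneq X N.+1) => [->|Hne]; first lra.
have {}IH := IH ltac:(lia).
have -> : squares_sum d N.+1 = squares_sum d N + LambdaDA d d.-1 N.+1 / (INR N.+1)² by [].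
have H3 : 3 <= INR N by rewrite (_ : 3 = INR 3); [apply/le_INR/leP; lia | rewrite /=; lra].
have := log_square_tail H3; rewrite -S_INR.
have : LambdaDA d d.-1 N.+1 / (INR N.+1)² <= ln (INR N.+1) / (INR N.+1)².
  apply: Rmult_le_compat_r.
    left; apply: Rinv_0_lt_compat; apply: Rlt_0_sqr; have := @INR_gt0 N.+1 isT; lra.
  by apply: Rle_trans (LambdaDA_le_Lam _ _ _) (Lam_le _).
lra.
Qed.

(** The integers counted by [evens] are the squares of prime powers s = p^j with p = -1 (mod d), so
    the sum may be indexed by s. The new sum has an integrable tail, of order log X / X beyond X. *)
Lemma Esum_le_squares d N : d \in [:: 3; 4]%N -> Esum d N <= squares_sum d N.
Proof.
move=> Hd; apply: (@sum_reindex_le _ (fun s => s ^ 2)%N).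
  by move=> s; rewrite /Rdiv; apply: Rmult_le_pos; [exact: LambdaDA_ge0 | case: s => [|s]; [rewrite /Rsqr /= Rmult_0_l Rinv_0; lra | left; apply/Rinv_0_lt_compat/Rlt_0_sqr; have := @INR_gt0 s.+1 isT; lra]].
move=> n Hn; rewrite /evens; case: Z.eqb_spec => [Hchi|_]; last by rewrite /Rdiv Rmult_0_l.
case: (LamP n) => [p r Pp Hr En|Hno]; last by rewrite LambdaDA_other // /Rdiv Rmult_0_l.
rewrite (_ : LambdaDA d d.-1 n = if (p %% d == d.-1 %% d)%N then ln (INR p) else 0); last by rewrite En LambdaDA_prime_power.
case: ifP => [/eqP E|_]; last by rewrite /Rdiv Rmult_0_l.
have Hd2 : (d.-1 %% d = d.-1)%N by move: Hd; rewrite !inE => /orP[]/eqP->.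
have Hd3 : (d.-1 == 1)%N = false by move: Hd; rewrite !inE => /orP[]/eqP->.
have Heven : ~~ odd r.
  by move: Hchi; rewrite En chi_exp // /chi E Hd2 Hd3 eqxx pow_neg1; case: odd.
move=> _.
have Er : r = (r./2 * 2)%N by have := odd_double_half r; rewrite (negbTE Heven); lia.
have Es : n = ((p ^ r./2) ^ 2)%N by rewrite -expnM -Er.
exists (p ^ r./2)%N.
  have Hs : (0 < p ^ r./2)%N by rewrite expn_gt0 prime_gt0.
  by rewrite Hs; move: Hn; rewrite Es; nia.
split=> //; rewrite LambdaDA_prime_power //; last by lia.
rewrite E Hd2 eqxx; right; congr (_ / _).
by rewrite {1}Es INR_expn /Rsqr /=; ring.
Qed.

(** * Fixed-point enclosures *)

Definition scale : Z := 1000000000000%Z.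

Definition encloses (I : Z * Z) (x : R) : Prop := IZR I.1 <= x * IZR scale <= IZR I.2.

Definition addI (I J : Z * Z) : Z * Z := (I.1 + J.1, I.2 + J.2)%Z.

(** [Z.div] rounds down for positive q whatever the sign of the numerator, so the floor below and
    the floor plus one above round outwards. *)
Definition divI (I : Z * Z) (q : Z) : Z * Z := (I.1 / q, I.2 / q + 1)%Z.

Definition mulI (a : Z) (I : Z * Z) : Z * Z :=
  if (0 <=? a)%Z then (a * I.1, a * I.2)%Z else (a * I.2, a * I.1)%Z.

Definition ratI (a q : Z) : Z * Z := divI (a * scale, a * scale)%Z q.

Lemma scale_gt0 : 0 < IZR scale.
Proof. by apply: IZR_lt. Qed.

Lemma Zdiv_bounds a q : (0 < q)%Z -> IZR (a / q) <= IZR a / IZR q <= IZR (a / q + 1).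
Proof.
move=> Hq; have H0 : 0 < IZR q by apply: IZR_lt.
have H1 := Z.mul_div_le a q Hq; have H2 := Z.mul_succ_div_gt a q Hq.
split; apply: (Rmult_le_reg_r (IZR q)) => //.
all: rewrite (_ : IZR a / IZR q * IZR q = IZR a); [rewrite -mult_IZR; apply: IZR_le; lia | field; lra].
Qed.

Lemma enclosesD I J x y : encloses I x -> encloses J y -> encloses (addI I J) (x + y).
Proof. by rewrite /encloses /addI /= !plus_IZR; lra. Qed.

Lemma encloses0 : encloses (0, 0)%Z 0.
Proof. by rewrite /encloses /=; lra. Qed.

Lemma enclosesV I x q : (0 < q)%Z -> encloses I x -> encloses (divI I q) (x / IZR q).
Proof.
move=> Hq [H1 H2]; have H0 : 0 < IZR q by apply: IZR_lt.
have [H3 _] := Zdiv_bounds I.1 Hq; have [_ H4] := Zdiv_bounds I.2 Hq.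
have E : x / IZR q * IZR scale = (x * IZR scale) / IZR q by field; lra.
have Hi : 0 <= / IZR q by left; apply: Rinv_0_lt_compat.
split; rewrite /= E.
  by apply: Rle_trans H3 _; apply: Rmult_le_compat_r.
by apply: Rle_trans H4; apply: Rmult_le_compat_r.
Qed.

Lemma enclosesZ a I x : encloses I x -> encloses (mulI a I) (IZR a * x).
Proof.
move=> [H1 H2]; rewrite /mulI; case: Z.leb_spec => Ha; rewrite /encloses /= !mult_IZR.
  by have := IZR_le _ _ Ha; nra.
by have := IZR_lt _ _ Ha; nra.
Qed.

Lemma encloses_ratI a q : (0 < q)%Z -> encloses (ratI a q) (IZR a / IZR q).
Proof. by move=> Hq; apply: enclosesV => //; rewrite /encloses /= !mult_IZR; lra. Qed.

Fixpoint sumI (f : nat -> Z * Z) (n : nat) : Z * Z :=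
  if n is m.+1 then addI (sumI f m) (f m.+1) else (0, 0)%Z.

Lemma encloses_sum f F n :
  (forall k, (0 < k <= n)%N -> encloses (f k) (F k)) -> encloses (sumI f n) (sum1 F n).
Proof.
elim: n => [|n IH] H /=; first exact: encloses0.
by apply: enclosesD; [apply: IH => k Hk; apply: H; lia | apply: H; lia].
Qed.

(** All prefixes are tested in a single pass with a running enclosure, so the cost is linear in
    n. *)
Fixpoint checked_sum (f : nat -> Z * Z) (ok : nat -> Z * Z -> bool) (n : nat) : option (Z * Z) :=
  if n is m.+1 then
    if checked_sum f ok m is Some A then
      let J := addI A (f m.+1) in if ok m.+1 J then Some J else None
    else None
  else Some (0, 0)%Z.

Lemma checked_sumP f ok n I : checked_sum f ok n = Some I ->
  I = sumI f n /\ forall k, (0 < k <= n)%N -> ok k (sumI f k).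
Proof.
elim: n I => [|n IH] I /=; first by case=> <-; split=> // k; lia.
case E: (checked_sum f ok n) => [J|] //; have [-> Hok] := IH _ E.
case: ifP => // Hn [<-]; split=> // k Hk.
by case: (eqVneq k n.+1) => [->//|Hne]; apply: Hok; lia.
Qed.

Definition linI (c : seq (nat * Z)) (F : nat -> Z * Z) : Z * Z :=
  foldr (fun jc acc => addI (mulI jc.2 (F jc.1)) acc) (0, 0)%Z c.

Lemma encloses_lin c F G :
  (forall j, j \in map fst c -> encloses (F j) (G j)) -> encloses (linI c F) (lin c G).
Proof.
elim: c => [|[j a] c IH] H /=; first exact: encloses0.
apply: enclosesD; first by apply: enclosesZ; apply: H; rewrite inE eqxx.
by apply: IH => i Hi; apply: H; rewrite inE Hi orbT.
Qed.

(* With z = 1/(2n+1) one has (n+1)/n = (1+z)/(1-z), and the Taylor polynomial of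
   ln((1+z)/(1-z)) is truncated after z^9; the remainder is at most
   2 z^11 / (11 (1 - z^2)). *)
Definition log_step_terms (q : Z) : seq (Z * Z) :=
  [:: (2, q); (2, 3 * q ^ 3); (2, 5 * q ^ 5); (2, 7 * q ^ 7); (2, 9 * q ^ 9)]%Z.

Definition log_stepI (n : Z) : Z * Z :=
  let q := (2 * n + 1)%Z in
  let s := foldr (fun t acc => addI (ratI t.1 t.2) acc) (0, 0)%Z (log_step_terms q) in
  (s.1, s.2 + (ratI 2 (11 * q ^ 9 * (q ^ 2 - 1))).2)%Z.

(** Both differences vanish at 0 and have the nonnegative derivatives 2 t^10/(1 - t^2) and (4/11)
    t^12/(1 - t^2)^2. *)
Lemma atanh_taylor_bounds z : 0 <= z -> z < 1 ->
  let T := 2 * z + 2 / 3 * z ^ 3 + 2 / 5 * z ^ 5 + 2 / 7 * z ^ 7 + 2 / 9 * z ^ 9 in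
  T <= ln (1 + z) - ln (1 - z) <= T + 2 / 11 * (z ^ 11 / (1 - z ^ 2)).
Proof.
move=> Hz0 Hz1 T.
have Hmono : forall f f', f 0 = 0 ->
  (forall t, 0 <= t <= z -> derivable_pt_lim f t (f' t) /\ 0 <= f' t) -> 0 <= f z.
  move=> f f' Hf0 Hf; case: Hz0 => [Hz|<-]; last by rewrite Hf0; lra.
  have [t [Et [Ht1 Ht2]]] := MVT_cor2 f f' 0 z Hz (fun t Ht => proj1 (Hf t Ht)).
  have [_ H] := Hf t ltac:(lra).
  by move: Et; rewrite Hf0; nra.
split.
  suff : 0 <= ln (1 + z) - ln (1 - z) - T by lra.
  apply: (Hmono (fun t => ln (1 + t) - ln (1 - t) - (2 * t + 2 / 3 * t ^ 3 + 2 / 5 * t ^ 5 + 2 / 7 * t ^ 7 + 2 / 9 * t ^ 9)) (fun t => 2 * t ^ 10 / (1 - t ^ 2))).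
    by rewrite Rplus_0_r Rminus_0_r; ring.
  move=> t Ht; have Hd : 0 < 1 - t ^ 2 by nra.
  split; last by apply: Rle_mult_inv_pos => //; have := pow_le t 10; lra.
  by apply/is_derive_Reals; auto_derive; [lra | field; split; [lra | split; nra]].
suff : 0 <= T + 2 / 11 * (z ^ 11 / (1 - z ^ 2)) - (ln (1 + z) - ln (1 - z)) by lra.
apply: (Hmono (fun t => (2 * t + 2 / 3 * t ^ 3 + 2 / 5 * t ^ 5 + 2 / 7 * t ^ 7 + 2 / 9 * t ^ 9) + 2 / 11 * (t ^ 11 / (1 - t ^ 2)) - (ln (1 + t) - ln (1 - t))) (fun t => 4 / 11 * t ^ 12 / (1 - t ^ 2) ^ 2)).
  by rewrite Rplus_0_r Rminus_0_r; field.
move=> t Ht; have Hd : 0 < 1 - t ^ 2 by nra.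
split; last by apply: Rle_mult_inv_pos; [have := pow_le t 12; lra | apply: pow_lt].
by apply/is_derive_Reals; auto_derive; [repeat split; lra | field; split; [lra | split; nra]].
Qed.

Lemma encloses_log_step n : (0 < n)%Z ->
  encloses (log_stepI n) (ln (IZR n + 1) - ln (IZR n)).
Proof.
move=> Hn; have H1 : 1 <= IZR n by apply: IZR_le; lia.
set q := (2 * n + 1)%Z; set z := / IZR q.
have Eq : IZR q = 2 * IZR n + 1 by rewrite /q plus_IZR mult_IZR.
have Hq3 : 3 <= IZR q by lra.
have Hz0 : 0 < z by apply: Rinv_0_lt_compat; lra.
have Hz1 : z < 1 by rewrite /z -Rinv_1; apply: Rinv_lt_contravar; lra.
have E : ln (IZR n + 1) - ln (IZR n) = ln (1 + z) - ln (1 - z).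
  rewrite -!ln_minus; try lra; congr ln; rewrite /z Eq; field; split; [lra | split; lra].
have Hs : encloses (foldr (fun t acc => addI (ratI t.1 t.2) acc) (0, 0)%Z (log_step_terms q))
  (2 * z + 2 / 3 * z ^ 3 + 2 / 5 * z ^ 5 + 2 / 7 * z ^ 7 + 2 / 9 * z ^ 9).
  have -> : 2 * z + 2 / 3 * z ^ 3 + 2 / 5 * z ^ 5 + 2 / 7 * z ^ 7 + 2 / 9 * z ^ 9 =
    foldr (fun t acc => IZR t.1 / IZR t.2 + acc) 0 (log_step_terms q).
    cbn [foldr log_step_terms fst snd]; rewrite !mult_IZR /z.
    by field; lra.
  have : all (fun t => 0 <? t.2)%Z (log_step_terms q).
    have Hq : (0 < q)%Z by rewrite /q; lia.
    cbn [all log_step_terms fst snd].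
    by do 5!(apply/andP; split; first by apply/Z.ltb_lt; nia).
  elim: (log_step_terms q) => [|t s IH] /=; first by move=> _; exact: encloses0.
  by case/andP=> /Z.ltb_lt Ht /IH Hs; apply: enclosesD => //; apply: encloses_ratI.
have Hr : encloses (ratI 2 (11 * q ^ 9 * (q ^ 2 - 1))) (2 / 11 * (z ^ 11 / (1 - z ^ 2))).
  have -> : 2 / 11 * (z ^ 11 / (1 - z ^ 2)) = IZR 2 / IZR (11 * q ^ 9 * (q ^ 2 - 1)).
    rewrite (_ : (q ^ 2 = q * q)%Z); last ring.
    rewrite !mult_IZR minus_IZR !mult_IZR /z; field.
    by split; nra.
  apply: encloses_ratI; have : (9 <= q ^ 2)%Z by nia.
  have : (0 < q ^ 9)%Z by apply: Z.pow_pos_nonneg; lia.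
  by nia.
have [Ht1 Ht2] := atanh_taylor_bounds (Rlt_le _ _ Hz0) Hz1.
have HS := Rlt_le _ _ scale_gt0.
have [Hs1 Hs2] := Hs; have [_ Hr2] := Hr.
rewrite E; split; rewrite /log_stepI -/q; cbn [fst snd].
  by apply: Rle_trans Hs1 _; apply: Rmult_le_compat_r.
rewrite plus_IZR; apply: Rle_trans (Rmult_le_compat_r _ _ _ HS Ht2) _.
by rewrite Rmult_plus_distr_r; apply: Rplus_le_compat.
Qed.

Fixpoint log_list (fuel : nat) (n : Z) (I : Z * Z) : seq (Z * Z) :=
  if fuel is k.+1 then I :: log_list k (n + 1)%Z (addI I (log_stepI n)) else [::].

Lemma encloses_log_list fuel n I k : (0 < n)%N -> (k < fuel)%N ->
  encloses I (ln (INR n)) ->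
  encloses (nth (0, 0)%Z (log_list fuel (Z.of_nat n) I) k) (ln (INR (n + k)%N)).
Proof.
elim: fuel n I k => // fuel IH n I [|k] Hn Hk HI /=; first by rewrite addn0.
rewrite -addSnnS; have -> : (Z.of_nat n + 1 = Z.of_nat n.+1)%Z by lia.
apply: IH => //.
have -> : ln (INR n.+1) = ln (INR n) + (ln (IZR (Z.of_nat n) + 1) - ln (IZR (Z.of_nat n))).
  by rewrite -INR_IZR_INZ S_INR; ring.
by apply: enclosesD => //; apply: encloses_log_step; lia.
Qed.

(** The table reaches 2001 because the lower bound at N = 2000 involves log(N+1). It is stored in
    normal form so that later checks only look it up. *)
Definition log_table : seq (Z * Z) := Eval vm_compute in log_list 2001 1 (0, 0)%Z.

Definition logI (n : nat) : Z * Z := nth (0, 0)%Z log_table n.-1.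

Lemma encloses_log n : (0 < n <= 2001)%N -> encloses (logI n) (ln (INR n)).
Proof.
move=> Hn; rewrite /logI; have -> : log_table = log_list 2001 (Z.of_nat 1) (0, 0)%Z by vm_cast_no_check (erefl log_table).
have {2}-> : n = (1 + n.-1)%N by lia.
by apply: encloses_log_list; [|lia|rewrite ln_1; exact: encloses0].
Qed.

(** * The range N <= 2000 *)

Definition overI (I : Z * Z) (n : nat) : Z * Z := divI I (Z.of_nat n).

Lemma encloses_over I x n : (0 < n)%N -> encloses I x -> encloses (overI I n) (x / INR n).
Proof. by move=> Hn HI; rewrite INR_IZR_INZ; apply: enclosesV => //; lia. Qed.

(** The default residue 0 is harmless: its interval is zero, so the entry contributes nothing to any
    class. *)
Definition prime_power_entry (n : nat) : nat * (Z * Z) :=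
  if primes n is [:: p] then (p %% 12, logI p)%N else (0%N, (0, 0)%Z).

(* Entry n - 1 holds the prime p mod 12 (which determines p mod 3 and p mod 4) and log p if
   n is a power of p. *)
Definition prime_power_table : seq (nat * (Z * Z)) :=
  Eval vm_compute in [seq prime_power_entry n | n <- iota 1 2001].

Lemma nth_prime_power_table n : (0 < n <= 2001)%N ->
  nth (0%N, (0, 0)%Z) prime_power_table n.-1 = prime_power_entry n.
Proof.
move=> Hn.
have -> : prime_power_table = [seq prime_power_entry n | n <- iota 1 2001].
  by vm_cast_no_check (erefl prime_power_table).
rewrite (nth_map 0%N) ?size_iota; last lia.
by rewrite nth_iota; [congr prime_power_entry; lia | lia].
Qed.

Definition LamI (n : nat) : Z * Z := (nth (0%N, (0, 0)%Z) prime_power_table n.-1).2.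

Definition LambdaI (d a n : nat) : Z * Z :=
  let e := nth (0%N, (0, 0)%Z) prime_power_table n.-1 in
  if (e.1 %% d == a %% d)%N then e.2 else (0, 0)%Z.

Lemma encloses_Lam n : (0 < n <= 2001)%N -> encloses (LamI n) (Lam n).
Proof.
move=> Hn; rewrite /LamI nth_prime_power_table // /prime_power_entry /Lam.
case E: (primes n) => [|p [|q s]]; try exact: encloses0.
apply: encloses_log; have : p \in primes n by rewrite E inE.
by rewrite mem_primes => /and3P[/prime_gt0 -> _ /dvdn_leq]; lia.
Qed.

Lemma encloses_LambdaDA d a n : (d %| 12)%N -> (0 < n <= 2001)%N ->
  encloses (LambdaI d a n) (LambdaDA d a n).
Proof.
move=> Hd Hn; have := encloses_Lam Hn.
rewrite /LambdaI /LamI nth_prime_power_table // /prime_power_entry /LambdaDA /Lam.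
case E: (primes n) => [|p [|q s]] /= H; try by case: ifP => _; exact: encloses0.
by rewrite modn_dvdm //; case: ifP => _; last exact: encloses0.
Qed.

Definition HI (d a n : nat) : Z * Z := overI (LambdaI d a n) n.

Lemma encloses_Hsum d a N : (d %| 12)%N -> (N <= 2001)%N -> encloses (sumI (HI d a) N) (Hsum d a N).
Proof.
move=> Hd HN; apply: encloses_sum => k Hk; apply: encloses_over; first lia.
by apply: encloses_LambdaDA => //; lia.
Qed.

(** [lo] and [hi] list the indices exempt from the lower and the upper test. The bounds are in
    thousandths, and everything is doubled to avoid halving a logarithm. H is constant on [k, k+1),
    so the lower test uses log(k+1) and the upper one log k. *)
Definition in_range (lo hi : seq nat) (blo bhi : Z) (k : nat) (I : Z * Z) : bool :=
  ((k \in lo) || (2 * blo * 1000000000 <=? 2 * I.1 - (logI k.+1).2)%Z) &&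
  ((k \in hi) || (2 * I.2 - (logI k).1 <=? 2 * bhi * 1000000000)%Z).

Lemma in_range_sound d a lo hi blo bhi k :
  (d %| 12)%N -> (0 < k <= 2000)%N -> in_range lo hi blo bhi k (sumI (HI d a) k) ->
  (k \notin lo -> IZR blo / 1000 <= Hsum d a k - ln (INR k.+1) / 2) /\
  (k \notin hi -> Hsum d a k - ln (INR k) / 2 <= IZR bhi / 1000).
Proof.
move=> Hd Hk /andP[Hlo Hhi].
have [H1 H2] := @encloses_Hsum d a k Hd ltac:(lia).
have [L1 L2] := @encloses_log k.+1 ltac:(lia).
have [M1 M2] := @encloses_log k ltac:(lia).
have HS : IZR scale = 1000000000000 by [].
rewrite HS in H1 H2 L1 L2 M1 M2.
split=> /negbTE E.
  move: Hlo; rewrite E orFb => /Z.leb_le/IZR_le; rewrite minus_IZR !mult_IZR; lra.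
move: Hhi; rewrite E orFb => /Z.leb_le/IZR_le; rewrite minus_IZR !mult_IZR; lra.
Qed.

Lemma Hsum_range d a lo hi blo bhi :
  (d %| 12)%N -> isSome (checked_sum (HI d a) (in_range lo hi blo bhi) 2000) ->
  forall k, (0 < k <= 2000)%N ->
  (k \notin lo -> IZR blo / 1000 <= Hsum d a k - ln (INR k.+1) / 2) /\
  (k \notin hi -> Hsum d a k - ln (INR k) / 2 <= IZR bhi / 1000).
Proof.
move=> Hd; case E: checked_sum => [J|] // _ k Hk; have [_ Hok] := checked_sumP E.
by apply: (@in_range_sound d a lo hi blo bhi k Hd Hk); apply: Hok.
Qed.

(** The exemptions here and below are the extremal indices. At N = 1 the value is exactly 0, which
    outward rounding cannot certify as nonpositive. For (4,3) the infimum occurs at N = 6, and for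
    (3,2) at both N = 1 and N = 3, where the value is -(log 2)/2; these are treated exactly. *)
Lemma Hsum_range41 : isSome (checked_sum (HI 4 1) (in_range [::] [:: 1%N] (-1010) 0) 2000).
Proof. by vm_compute. Qed.
Lemma Hsum_range43 : isSome (checked_sum (HI 4 3) (in_range [:: 6%N] [:: 1%N] (-600) 0) 2000).
Proof. by vm_compute. Qed.
Lemma Hsum_range31 : isSome (checked_sum (HI 3 1) (in_range [::] [:: 1%N] (-1150) 0) 2000).
Proof. by vm_compute. Qed.
Lemma Hsum_range32 : isSome (checked_sum (HI 3 2) (in_range [:: 1; 3]%N [::] (-300) 200) 2000).
Proof. by vm_compute. Qed.

(** * The kernels *)

(* The residue of n mod d and n itself (in binary) are carried along with the sum. *)
Fixpoint L_run (d n : nat) : nat * Z * (Z * Z) :=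
  if n is m.+1 then
    let: (r, z, A) := L_run d m in
    let r' := if r.+1 == d then 0%N else r.+1 in
    let z' := (z + 1)%Z in
    (r', z', addI A (ratI (chi d r') z'))
  else (0%N, 0%Z, (0, 0)%Z).

Lemma L_runP d n : (0 < d)%N ->
  L_run d n = (n %% d, Z.of_nat n, (L_run d n).2)%N /\ encloses (L_run d n).2 (Lsum (chi d) n).
Proof.
move=> Hd; elim: n => [|n [IH1 IH2]]; first by rewrite mod0n; split=> //; exact: encloses0.
have Hz : (Z.of_nat n + 1 = Z.of_nat n.+1)%Z by lia.
have Hr : (if (n %% d).+1 == d then 0 else (n %% d).+1)%N = (n.+1 %% d)%N.
  rewrite -[in RHS]addn1 -modnDml addn1; move: (n %% d)%N (ltn_pmod n Hd) => r Hr.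
  case: eqP => [->|Hne]; first by rewrite modnn.
  by rewrite modn_small //; lia.
rewrite [L_run d n.+1]/= IH1 Hr Hz; split=> //=; apply: enclosesD => //.
by rewrite chi_mod INR_IZR_INZ; apply: encloses_ratI; lia.
Qed.

Definition widen (I : Z * Z) (e : Z) : Z * Z := (I.1 - e, I.2 + e)%Z.

Lemma encloses_widen I x y e : encloses I x -> Rabs (y - x) * IZR scale <= IZR e ->
  encloses (widen I e) y.
Proof.
have HS := scale_gt0; move=> [H1 H2] He; rewrite /encloses /widen /= minus_IZR plus_IZR.
have : Rabs (y - x) * IZR scale = Rabs (y * IZR scale - x * IZR scale).
  by rewrite -Rmult_minus_distr_r Rabs_mult (Rabs_pos_eq (IZR scale)); lra.
move=> E; rewrite E in He.
by have := Rle_abs (y * IZR scale - x * IZR scale); have := Rle_abs (- (y * IZR scale - x * IZR scale)); rewrite Rabs_Ropp; lra.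
Qed.

(** With 30000 terms the tail of the series for L(1,chi) is at most 1/30001; [L_oneI] widens the
    enclosure by slightly more than that. *)
Definition L_length : nat := (30 * 1000)%N.

Definition L_table : (Z * Z) * (Z * Z) :=
  Eval vm_compute in ((L_run 3 L_length).2, (L_run 4 L_length).2).

Lemma L_tableE : L_table = ((L_run 3 L_length).2, (L_run 4 L_length).2).
Proof. by vm_cast_no_check (erefl L_table). Qed.

Lemma L_run_pair n (p := ((L_run 3 n).2, (L_run 4 n).2)) :
  encloses p.1 (Lsum (chi 3) n) /\ encloses p.2 (Lsum (chi 4) n).
Proof. by split; [case: (@L_runP 3 n isT) | case: (@L_runP 4 n isT)]. Qed.

Definition L_oneI (d : nat) : Z * Z :=
  widen (if d == 4%N then L_table.2 else L_table.1) (scale / 30000).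

Lemma encloses_L_one d L : d \in [:: 3; 4]%N ->
  (forall m, (0 < m)%N -> Rabs (L - Lsum (chi d) m) <= / INR m.+1) ->
  encloses (L_oneI d) L.
Proof.
move=> Hd HL; have [H3 H4] := L_run_pair L_length; rewrite -L_tableE in H3 H4.
have H : encloses (if d == 4%N then L_table.2 else L_table.1) (Lsum (chi d) L_length).
  by move: Hd; rewrite !inE => /orP[]/eqP->; [exact: H3 | exact: H4].
apply: encloses_widen H _.
have := HL L_length isT; have : 0 < IZR scale by exact: scale_gt0.
have E : (30001 <= INR L_length.+1).
  by rewrite /L_length INR_IZR_INZ; apply: IZR_le; lia.
have : / INR L_length.+1 <= / 30001 by apply: Rinv_le_contravar; lra.
have : / 30001 * IZR scale <= IZR (scale / 30000).
  by rewrite (_ : IZR scale = 1000000000000) // (_ : (scale / 30000 = 33333333)%Z) //; lra.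
nra.
Qed.

(* Found by linear programming: truncations of sum_j mu(j) j^(-s) and
   sum_j mu(j) chi(j) j^(-s), adjusted so that both kernels tend to a limit near 10^4.
   The staircase [steps] dominates the resulting discrepancy. *)
Definition c_zeta : seq (nat * Z) :=
  [:: (1%N, 10000); (2%N, -5000); (3%N, -3334); (5%N, -2058); (6%N, 1724); (7%N, -1397);
      (10%N, 497); (12%N, -432)]%Z.

Definition c_L (d : nat) : seq (nat * Z) :=
  if d == 4%N then [:: (1%N, 10000); (3%N, 3333); (5%N, -1166); (7%N, 565)]%Z
  else [:: (1%N, 10000); (2%N, 5000); (5%N, 1540)]%Z.

Definition steps (d : nat) : seq (nat * Z) :=
  if d == 4%N then [:: (1%N, 6); (5%N, 584); (11%N, 1050); (41%N, 390); (160%N, 280); (300%N, 3230)]%Z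
  else [:: (1%N, 6); (5%N, 334); (7%N, 670); (11%N, 350); (22%N, 170); (110%N, 290); (300%N, 2520)]%Z.

Definition thetaI : Z * Z := linI c_zeta (fun j => mulI (-1) (logI j)).
Definition gI (d : nat) : Z * Z := mulI (coef_sum (c_L d)) (L_oneI d).

Definition GI (phi : nat -> Z) (c : seq (nat * Z)) (m : nat) : Z * Z :=
  sumI (fun k => ratI (eta phi c k) (Z.of_nat k)) m.

Lemma encloses_Gker phi c m : all (fun jc => 0 < jc.1)%N c -> encloses (GI phi c m) (Gker phi c m).
Proof.
move=> Hc; rewrite Gker_eta //; apply: encloses_sum => k Hk.
by rewrite INR_IZR_INZ; apply: encloses_ratI; lia.
Qed.

(** * Verified computation of the kernel inequality *)

Definition max_dist (I J : Z * Z) : Z := Z.max (I.2 - J.1) (J.2 - I.1).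

Lemma max_dist_sound I J x y : encloses I x -> encloses J y ->
  Rabs (x - y) * IZR scale <= IZR (max_dist I J).
Proof.
move=> [H1 H2] [H3 H4]; have HS := scale_gt0; rewrite -{1}(Rabs_pos_eq (IZR scale)); last lra.
rewrite -Rabs_mult; apply: Rabs_le; rewrite /max_dist.
have := IZR_le _ _ (Z.le_max_l (I.2 - J.1) (J.2 - I.1)).
have := IZR_le _ _ (Z.le_max_r (I.2 - J.1) (J.2 - I.1)).
rewrite !minus_IZR; lra.
Qed.

Definition step_val (kap : seq (nat * Z)) (m : nat) : Z :=
  foldr (fun ka s => (if (ka.1 <= m)%N then ka.2 else 0) + s)%Z 0%Z kap.

Lemma step_sum_val kap m : step_sum kap m = IZR (step_val kap m).
Proof.
by rewrite /step_sum; elim: kap => [|[k a] kap IH] //=; rewrite IH plus_IZR; case: ifP => _; ring.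
Qed.

(** The inequality D0/th + D1/g <= kappa/1000 with denominators cleared, and with th and g replaced
    by their lower endpoints, which are required to be positive. *)
Definition ok_at (th g : Z * Z) (D0 D1 kappa : Z) : bool :=
  ((0 <? th.1) && (0 <? g.1) && (1000 * (D0 * g.1 + D1 * th.1) <=? kappa * th.1 * g.1))%Z.

Lemma ok_at_sound I J D0 D1 kappa theta g x y :
  encloses I theta -> encloses J g -> ok_at I J D0 D1 kappa ->
  0 <= x -> 0 <= y -> x * IZR scale <= IZR D0 -> y * IZR scale <= IZR D1 ->
  x / theta + y / g <= IZR kappa / 1000.
Proof.
move=> [H1 _] [H2 _] /andP[/andP[/Z.ltb_lt/IZR_lt P1 /Z.ltb_lt/IZR_lt P2] /Z.leb_le/IZR_le].
have HS := scale_gt0; rewrite !mult_IZR plus_IZR !mult_IZR => H Hx Hy Hx0 Hy0.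
set S := IZR scale in HS H1 H2 Hx0 Hy0.
have Hb : forall t D u T, 0 < T -> T <= u * S -> 0 <= t -> t * S <= D -> t / u <= D / T.
  move=> t D u T HT Hu Ht HD; have Hu0 : 0 < u by nra.
  apply: (Rmult_le_reg_r (u * T)); first by nra.
  have -> : t / u * (u * T) = t * T by field; lra.
  have -> : D / T * (u * T) = D * u by field; lra.
  by nra.
have K1 := Hb _ _ _ _ P1 H1 Hx Hx0; have K2 := Hb _ _ _ _ P2 H2 Hy Hy0.
apply: Rle_trans (Rplus_le_compat _ _ _ _ K1 K2) _.
apply: (Rmult_le_reg_r (1000 * (IZR I.1 * IZR J.1))); first by nra.
have -> : (IZR D0 / IZR I.1 + IZR D1 / IZR J.1) * (1000 * (IZR I.1 * IZR J.1)) =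
  1000 * (IZR D0 * IZR J.1 + IZR D1 * IZR I.1) by field; lra.
by have -> : IZR kappa / 1000 * (1000 * (IZR I.1 * IZR J.1)) = IZR kappa * IZR I.1 * IZR J.1 by field.
Qed.

Fixpoint kernel_run (d : nat) (J : Z * Z) (n : nat) : option ((Z * Z) * (Z * Z)) :=
  if n is m.+1 then
    if kernel_run d J m is Some (A, B) then
      let A' := addI A (ratI (eta one_char c_zeta n) (Z.of_nat n)) in
      let B' := addI B (ratI (eta (chi d) (c_L d) n) (Z.of_nat n)) in
      if ok_at thetaI J (Z.of_nat n.+1 * max_dist thetaI A') (Z.of_nat n.+1 * max_dist J B')
           (step_val (steps d) n)
      then Some (A', B') else None
    else None
  else Some ((0, 0), (0, 0))%Z.

Lemma kernel_runP d J n S : kernel_run d J n = Some S ->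
  S = (GI one_char c_zeta n, GI (chi d) (c_L d) n) /\
  forall m, (0 < m <= n)%N ->
    ok_at thetaI J (Z.of_nat m.+1 * max_dist thetaI (GI one_char c_zeta m))
      (Z.of_nat m.+1 * max_dist J (GI (chi d) (c_L d) m)) (step_val (steps d) m).
Proof.
elim: n S => [|n IH] S; first by case=> <-; split=> // m; lia.
cbn [kernel_run]; case E: (kernel_run d J n) => [[A B]|] //.
have [[-> ->] Hok] := IH _ E; case: ifP => // Hn [<-]; split=> // m Hm.
by case: (eqVneq m n.+1) => [->//|Hne]; apply: Hok; lia.
Qed.

Definition kernel_ok (d : nat) : bool :=
  all (fun jc => (0 < jc.1) && (jc.1 * d %| 420) && (3 <= 2000 %/ jc.1))%N (c_L d) &&
  nonneg_steps (steps d) && all (fun ka => ka.1 <= 300)%N (steps d) &&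
  isSome (kernel_run d (gI d) 299).

(** Run over one period of f: a final value 0 makes the partial sums periodic, so the bounds tested
    on the way hold for all of them. *)
Fixpoint zsum_run (f : nat -> Z) (lo hi : Z) (n : nat) : option Z :=
  if n is m.+1 then
    if zsum_run f lo hi m is Some s then
      let t := (s + f n)%Z in if ((lo <=? t) && (t <=? hi))%Z then Some t else None
    else None
  else if ((lo <=? 0) && (0 <=? hi))%Z then Some 0%Z else None.

Lemma zsum_runP f lo hi n s : zsum_run f lo hi n = Some s ->
  s = zsum f n /\ forall k, (k <= n)%N -> (lo <=? zsum f k)%Z && (zsum f k <=? hi)%Z.
Proof.
elim: n s => [|n IH] s /=.
  by case: ifP => // H [<-]; split=> // k; rewrite leqn0 => /eqP->.
case E: (zsum_run f lo hi n) => [t|] //; have [-> Hok] := IH _ E.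
rewrite -zsumS; case: ifP => // Hn [<-]; split=> // k Hk.
by case: (eqVneq k n.+1) => [->//|Hne]; apply: Hok; lia.
Qed.

Lemma zsum_run_oscillation f lo hi q k l :
  (0 < q)%N -> (forall k, (0 < k)%N -> f (k + q)%N = f k) -> zsum_run f lo hi q = Some 0%Z ->
  IZR (zsum f k) - IZR (zsum f l) <= IZR (hi - lo).
Proof.
move=> Hq Hf /zsum_runP[H0 Hr]; apply: (zsum_oscillation (q := q)) => //.
by apply/allP => i; rewrite mem_iota => Hi; apply: Hr; lia.
Qed.

Definition is_some0 (o : option Z) : bool := if o is Some 0%Z then true else false.

Lemma is_some0P o : is_some0 o -> o = Some 0%Z.
Proof. by case: o => [[]|]. Qed.

(** 420 is a common period of both [eta], and the staircase has reached its full height at 300. That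
    height must cover the two oscillations divided by the limits, about 5.53 for d = 4 and 4.32 for
    d = 3, which accounts for the large last step. *)
Definition tail_ok (d : nat) (lo0 hi0 lo1 hi1 : Z) : bool :=
  is_some0 (zsum_run (eta one_char c_zeta) lo0 hi0 420) &&
  is_some0 (zsum_run (eta (chi d) (c_L d)) lo1 hi1 420) &&
  ok_at thetaI (gI d) ((hi0 - lo0) * scale) ((hi1 - lo1) * scale) (step_val (steps d) 300).

Lemma kernel_ok4 : kernel_ok 4.
Proof. by vm_compute. Qed.
Lemma kernel_ok3 : kernel_ok 3.
Proof. by vm_compute. Qed.
Lemma tail_ok4 : tail_ok 4 (-2758) 22699 (-5830) 23954.
Proof. by vm_compute. Qed.
Lemma tail_ok3 : tail_ok 3 (-2758) 22699 0 17700.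
Proof. by vm_compute. Qed.

Lemma encloses_theta : encloses thetaI (theta_of c_zeta).
Proof.
apply: encloses_lin => j Hj; have -> : - ln (INR j) = IZR (-1) * ln (INR j) by ring.
apply: enclosesZ; apply: encloses_log.
by move: Hj; rewrite !inE => /or4P[|||/or4P[|||/orP[]]] /eqP->.
Qed.

Lemma encloses_g d L : d \in [:: 3; 4]%N ->
  (forall m, (0 < m)%N -> Rabs (L - Lsum (chi d) m) <= / INR m.+1) ->
  encloses (gI d) (IZR (coef_sum (c_L d)) * L).
Proof. by move=> Hd HL; apply: enclosesZ; apply: encloses_L_one. Qed.

Opaque gI thetaI.

Lemma ok_at_gt0 I J D0 D1 kappa x y : ok_at I J D0 D1 kappa ->
  encloses I x -> encloses J y -> 0 < x /\ 0 < y.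
Proof.
move=> /andP[/andP[/Z.ltb_lt/IZR_lt P1 /Z.ltb_lt/IZR_lt P2] _] [H1 _] [H2 _].
have HS := scale_gt0; split; nra.
Qed.

(** For m <= 299 the kernels are enclosed one by one. From 300 on the staircase is constant, and the
    uniform tail bound from the oscillation of the partial sums of [eta] suffices. *)
Lemma kernel_pointwise d lo0 hi0 lo1 hi1 L m :
  d \in [:: 3; 4]%N -> kernel_ok d -> tail_ok d lo0 hi0 lo1 hi1 ->
  Un_cv (Lsum (chi d)) L ->
  (forall m, (0 < m)%N -> Rabs (L - Lsum (chi d) m) <= / INR m.+1) -> (0 < m)%N ->
  INR m.+1 * (Rabs (1 - Gker one_char c_zeta m / theta_of c_zeta) +
              Rabs (1 - Gker (chi d) (c_L d) m / (IZR (coef_sum (c_L d)) * L)))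
    <= step_sum (steps d) m / 1000.
Proof.
rewrite /kernel_ok /tail_ok.
move=> Hd /andP[/andP[/andP[Hc Hnn] Hle] Hrun] /andP[/andP[/is_some0P Ho0 /is_some0P Ho1] Hok] HcvL HL Hm.
case Er: (kernel_run d (gI d) 299) Hrun => [S|] // _; have [_ Hr] := kernel_runP Er => {Er S}.
have Hth := encloses_theta; have Hg := encloses_g Hd HL.
move: Hth Hg Hok Hr; move: thetaI (gI d) => I J Hth Hg Hok Hr.
have [Hth0 Hg0] := ok_at_gt0 Hok Hth Hg.
set theta := theta_of c_zeta in Hth Hth0 *; set g := IZR _ * L in Hg Hg0 *.
have Hc0 : all (fun jc => 0 < jc.1)%N c_zeta by [].
have Hc1 : all (fun jc => 0 < jc.1)%N (c_L d).
  by apply: sub_all Hc => jc /andP[/andP[]].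
have HM := INR_gt0 (ltn0Sn m); have HS := scale_gt0.
have E : forall G t, 0 < t -> Rabs (1 - G / t) = Rabs (t - G) / t.
  move=> G t Ht; have -> : 1 - G / t = (t - G) / t by field; lra.
  by rewrite /Rdiv Rabs_mult (Rabs_pos_eq (/ t)) //; left; apply: Rinv_0_lt_compat.
rewrite !E //; set x := Rabs (theta - _); set y := Rabs (g - _).
have -> : INR m.+1 * (x / theta + y / g) = INR m.+1 * x / theta + INR m.+1 * y / g by field; lra.
have Hx : 0 <= INR m.+1 * x by apply: Rmult_le_pos; [lra | exact: Rabs_pos].
have Hy : 0 <= INR m.+1 * y by apply: Rmult_le_pos; [lra | exact: Rabs_pos].
rewrite step_sum_val; case: (leqP m 299) => Hm300.
  have {}Hr := Hr m (introT andP (conj Hm Hm300)).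
  have Hb : forall I J u v, encloses I u -> encloses J v ->
      INR m.+1 * Rabs (u - v) * IZR scale <= IZR (Z.of_nat m.+1 * max_dist I J).
    move=> I' J' u v HI HJ; rewrite mult_IZR -INR_IZR_INZ Rmult_assoc.
    by apply: Rmult_le_compat_l; [lra | exact: max_dist_sound].
  apply: (ok_at_sound Hth Hg Hr Hx Hy); first exact: Hb Hth (encloses_Gker _ _ Hc0).
  exact: Hb Hg (encloses_Gker _ _ Hc1).
have -> : step_val (steps d) m = step_val (steps d) 300.
  elim: (steps d) Hle => [|[k a] kap IH] //= /andP[Hk /IH ->].
  by rewrite (leq_trans Hk Hm300) Hk.
apply: (ok_at_sound Hth Hg Hok Hx Hy).
  rewrite mult_IZR; apply: Rmult_le_compat_r; first lra.
  apply: (Gker_tail Hc0 _ (Gker_one_limit Hc0 _) Hm); last exact: erefl.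
  move=> k l; apply: (zsum_run_oscillation (q := 420)) Ho0 => [|i _]; first exact: isT.
  by apply: (@eta_periodic _ _ 1).
rewrite mult_IZR; apply: Rmult_le_compat_r; first lra.
apply: (Gker_tail Hc1 _ (Gker_limit Hc1 HcvL) Hm).
move=> k l; apply: (zsum_run_oscillation (q := 420)) Ho1 => [|i _]; first exact: isT.
apply: (@eta_periodic _ _ d); first by move=> j; exact: chi_periodic.
by apply: sub_all Hc => jc /andP[].
Qed.

(** * Numerical constants *)

Definition confined (lo hi : Z) (I : Z * Z) : bool :=
  ((lo * 1000000 <=? I.1) && (I.2 <=? hi * 1000000))%Z.

Lemma confined_sound lo hi I x : encloses I x -> confined lo hi I ->
  IZR lo / 1000000 <= x <= IZR hi / 1000000.
Proof.
move=> [H1 H2] /andP[/Z.leb_le/IZR_le H3 /Z.leb_le/IZR_le H4].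
have HS : IZR scale = 1000000000000 by [].
by rewrite HS in H1 H2; rewrite !mult_IZR in H3 H4; lra.
Qed.

(** Products of endpoints carry the square of [scale], hence the divisor. The fallback (0, -1)
    encloses nothing; it is avoided because the logarithms used have nonnegative lower endpoints. *)
Definition half_sqI (I : Z * Z) : Z * Z :=
  if (0 <=? I.1)%Z then divI (I.1 * I.1, I.2 * I.2)%Z (2 * scale) else (0, -1)%Z.

Lemma encloses_half_sq I x : (0 <= I.1)%Z -> encloses I x -> encloses (half_sqI I) (x² / 2).
Proof.
move=> H0 [H1 H2]; have HS := scale_gt0; have H0' := IZR_le _ _ H0.
rewrite /half_sqI (proj2 (Z.leb_le _ _) H0).
have -> : x² / 2 = x² * IZR scale / IZR (2 * scale) by rewrite mult_IZR; field; lra.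
apply: enclosesV => //; rewrite /encloses /Rsqr; cbn [fst snd]; rewrite !mult_IZR.
split; nra.
Qed.

Definition thetaI2 : Z * Z := linI c_zeta (fun j => half_sqI (logI j)).
Definition log_overI (c : seq (nat * Z)) : Z * Z :=
  linI (absc c) (fun j => overI (logI (2000 %/ j)) (2000 %/ j)).
Definition VI (d : nat) : Z * Z := sumI (fun k => mulI (chi d k) (overI (logI k) k)) 2000.
Definition stepsI (d : nat) : Z * Z := linI (steps d) (fun k => ratI 1 (Z.of_nat k)).
Definition EI (d : nat) : Z * Z :=
  sumI (fun k => overI (if (chi d k =? 1)%Z then LambdaI d d.-1 k else (0, 0)%Z) k) 2000.
Definition ZI (d : nat) : Z * Z :=
  sumI (fun k => overI (if (pdiv d %| k)%N then LamI k else (0, 0)%Z) k) 2000.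
Definition squaresI (d : nat) : Z * Z :=
  sumI (fun k => overI (overI (LambdaI d d.-1 k) k) k) 2000.

Lemma encloses_thetaI2 : encloses thetaI2 (log2_of c_zeta).
Proof.
have Hall : all (fun j => (0 < j <= 12)%N && (0 <=? (logI j).1)%Z) (map fst c_zeta) by vm_compute.
apply: encloses_lin => j Hj; have /andP[Hj12 /Z.leb_le Hlog] := allP Hall j Hj.
by apply: encloses_half_sq Hlog _; apply: encloses_log; lia.
Qed.

Lemma encloses_log_over c : all (fun jc => 0 < jc.1 <= 12)%N c ->
  encloses (log_overI c) (lin (absc c) (fun j => log_over (2000 %/ j)%N)).
Proof.
move=> Hc; apply: encloses_lin => j.
rewrite /absc -map_comp (@eq_map _ _ _ fst) // => Hj.
have Hj12 := @all_fst (fun j => 0 < j <= 12)%N c j Hc Hj.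
have H1 : (0 < 2000 %/ j)%N by rewrite divn_gt0; lia.
have H2 : (2000 %/ j <= 2000)%N by exact: leq_div.
by apply: encloses_over => //; apply: encloses_log; lia.
Qed.

Lemma encloses_V d : encloses (VI d) (Vsum (chi d) 2000).
Proof.
apply: encloses_sum => k Hk.
have -> : IZR (chi d k) / INR k * ln (INR k) = IZR (chi d k) * (ln (INR k) / INR k).
  by have : 0 < INR k by [apply: INR_gt0; lia]; move=> ?; field; lra.
apply: enclosesZ; apply: encloses_over; first lia.
by apply: encloses_log; lia.
Qed.

Lemma encloses_steps d : nonneg_steps (steps d) ->
  encloses (stepsI d) (lin (steps d) (fun k => / INR k)).
Proof.
move=> H; apply: encloses_lin => k Hk.
have Hk0 : (0 < k)%N by apply: (@all_fst (fun k => 0 < k)%N (steps d)) => //; apply: sub_all H => ka /andP[].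
by rewrite -Rdiv_1_l INR_IZR_INZ; apply: encloses_ratI; lia.
Qed.

Lemma encloses_E d : (d %| 12)%N -> encloses (EI d) (Esum d 2000).
Proof.
move=> Hd; apply: encloses_sum => k Hk; apply: encloses_over; first lia.
by rewrite /evens; case: ifP => _; [apply: encloses_LambdaDA => //; lia | exact: encloses0].
Qed.

Lemma encloses_Z d : encloses (ZI d) (Zsum d 2000).
Proof.
apply: encloses_sum => k Hk; apply: encloses_over; first lia.
by rewrite /ramified; case: ifP => _; [apply: encloses_Lam; lia | exact: encloses0].
Qed.

Lemma encloses_squares d : (d %| 12)%N -> encloses (squaresI d) (squares_sum d 2000).
Proof.
move=> Hd; apply: encloses_sum => k Hk.
have -> : LambdaDA d d.-1 k / (INR k)² = LambdaDA d d.-1 k / INR k / INR k.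
  have ? : 0 < INR k by apply: INR_gt0; lia.
  by rewrite /Rsqr; field; lra.
do 2!(apply: encloses_over; first lia).
by apply: encloses_LambdaDA => //; lia.
Qed.

Opaque VI stepsI EI ZI squaresI log_overI thetaI2 L_oneI.

(** The three error terms are the discrepancy of the kernels and the errors in the asymptotics of
    the two explicit sums, each divided by the limit of its kernel. The sum of the coefficients
    cancels from the chi main term, leaving [Vsum (chi d) 2000 / L], an approximation of
    -L'/L(1,chi). *)
Lemma twisted_bounds d lo0 hi0 lo1 hi1 :
  d \in [:: 3; 4]%N -> kernel_ok d -> tail_ok d lo0 hi0 lo1 hi1 ->
  exists L, [/\ encloses (L_oneI d) L, encloses (gI d) (IZR (coef_sum (c_L d)) * L) &
    forall N s, (2000 <= N)%N -> Rabs s <= 1 ->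
    Rabs (twisted_mertens (chi d) s N -
          (ln (INR N) + log2_of c_zeta / theta_of c_zeta + s * (Vsum (chi d) 2000 / L)))
    <= 2 * ln 2 * (lin (steps d) (fun k => / INR k) / 1000)
       + lin (absc c_zeta) (fun j => log_over (2000 %/ j)%N) / theta_of c_zeta
       + lin (absc (c_L d)) (fun j => log_over (2000 %/ j)%N) / (IZR (coef_sum (c_L d)) * L)].
Proof.
move=> Hd Hk Ht.
have Hps := fun k l => @chi_partial_sums d k l Hd.
have [L HcvL HL] := Lsum_limit Hps.
exists L; have HLe := encloses_L_one Hd HL; have Hg := encloses_g Hd HL; split=> // N s HN Hs.
have Hpt := fun m => kernel_pointwise Hd Hk Ht HcvL HL (m := m).
have [Hth0 Hg0] : 0 < theta_of c_zeta /\ 0 < IZR (coef_sum (c_L d)) * L.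
  by move/andP: Ht => [_ Hok]; exact: ok_at_gt0 Hok encloses_theta Hg.
move: Hk; rewrite /kernel_ok => /andP[/andP[/andP[Hc Hnn] _] _].
have Hc1 : all (fun jc => 0 < jc.1)%N (c_L d) by apply: sub_all Hc => jc /andP[/andP[]].
have Hc3 : all (fun jc => (0 < jc.1) && (3 <= 2000 %/ jc.1))%N (c_L d).
  by apply: sub_all Hc => jc /andP[/andP[-> _] ->].
have Hz3 : all (fun jc => (0 < jc.1) && (3 <= 2000 %/ jc.1))%N c_zeta by vm_compute.
have HN0 : (0 < N)%N by apply: leq_trans HN.
have K := @twisted_mertens_kernel (chi d) c_zeta (c_L d) (steps d) _ _ s N
  (fun n m => chi_mul n m Hd) (chi_abs d) Hs isT Hc1 Hnn HN0 Hth0 Hg0 Hpt.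
have K0 := @Tker_one_asymptotic c_zeta N 2000 erefl Hz3 HN.
have K1 := @Tker_asymptotic (chi d) (c_L d) N 2000 Hps Hc3 HN.
move: Hth0 Hg0 K K0 K1; set th := theta_of _; set sg := IZR (coef_sum _); set g := sg * L.
set T0 := Tker one_char _ _; set T1 := Tker (chi d) _ _; set V := Vsum _ _; set l2 := log2_of _.
set B0 := lin (absc c_zeta) _; set B1 := lin (absc (c_L d)) _; set U := 2 * ln 2 * _.
set W := twisted_mertens _ _ _; set x := ln (INR N) => Hth0 Hg0 K K0 K1.
have HL0 : L <> 0 by move=> E; move: Hg0; rewrite /g E; lra.
have Hsg : sg <> 0 by move=> E; move: Hg0; rewrite /g E; lra.
have -> : W - (x + l2 / th + s * (V / L)) =
  (W - (T0 / th + s * (T1 / g))) + (T0 - (th * x + l2)) / th + s * ((T1 - sg * V) / g).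
  by rewrite /g; field; repeat split; try lra.
have Hdiv : forall a b c, 0 < c -> Rabs a <= b -> Rabs (a / c) <= b / c.
  move=> a b c Hc0 Hab; rewrite /Rdiv Rabs_mult (Rabs_pos_eq (/ c)); last by left; exact: Rinv_0_lt_compat.
  by apply: Rmult_le_compat_r => //; left; exact: Rinv_0_lt_compat.
apply: Rle_trans (Rabs_triang _ _) _; apply: Rplus_le_compat.
  by apply: Rle_trans (Rabs_triang _ _) _; apply: Rplus_le_compat => //; exact: Hdiv.
rewrite Rabs_mult; have := Hdiv _ _ _ Hg0 K1; have := Rabs_pos ((T1 - sg * V) / g).
by have := Rabs_pos s; nra.
Qed.

Lemma Rdiv_bounds a b lo hi : 0 < b -> lo * b <= a <= hi * b -> lo <= a / b <= hi.
Proof.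
move=> Hb [H1 H2]; split; apply: (Rmult_le_reg_r b) => //; rewrite /Rdiv Rmult_assoc Rinv_l; lra.
Qed.

Lemma zeta_numerics :
  [&& confined 693146 693148 (logI 2), confined 1098611 1098613 (logI 3),
      confined 9999256600 9999273400 thetaI, confined (-5772307200) (-5772285700) thetaI2 &
      confined 0 220162000 (log_overI c_zeta)].
Proof. by vm_compute. Qed.

Lemma numerics4 :
  [&& confined 785348 785415 (L_oneI 4), confined 9999000000 10000000000 (gI 4),
      confined (-194804) (-194799) (VI 4), confined 0 240284000 (stepsI 4) &
      confined 0 99212000 (log_overI (c_L 4))].
Proof. by vm_compute. Qed.

Lemma numerics3 :
  [&& confined 604555 604623 (L_oneI 3), confined 9999300000 10000500000 (gI 3),
      confined (-223932) (-223926) (VI 3), confined 0 219097000 (stepsI 3) &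
      confined 0 95611000 (log_overI (c_L 3))].
Proof. by vm_compute. Qed.

Lemma ln2_bounds : 0.693146 <= ln 2 <= 0.693148.
Proof.
have /and5P[H _ _ _ _] := zeta_numerics.
have := confined_sound (@encloses_log 2 isT) H.
by rewrite (_ : INR 2 = 2); [lra | rewrite /=; lra].
Qed.

Lemma ln3_bounds : 1.098611 <= ln 3 <= 1.098613.
Proof.
have /and5P[_ H _ _ _] := zeta_numerics.
have := confined_sound (@encloses_log 3 isT) H.
by rewrite (_ : INR 3 = 3); [lra | rewrite /=; lra].
Qed.

(** As the sum of Lambda(n)/n is log N - gamma + o(1), the first ratio has to be close to -gamma =
    -0.57721...; it lies within 10^(-4) of it. *)
Lemma zeta_constants :
  -0.57728 <= log2_of c_zeta / theta_of c_zeta <= -0.57727 /\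
  lin (absc c_zeta) (fun j => log_over (2000 %/ j)%N) / theta_of c_zeta <= 0.02202.
Proof.
have /and5P[_ _ N1 N2 N3] := zeta_numerics.
have := confined_sound encloses_theta N1.
have := confined_sound encloses_thetaI2 N2.
have := confined_sound (@encloses_log_over c_zeta isT) N3.
move: (theta_of _) (log2_of _) (lin _ _) => t l b H3 H2 H1.
by split; [apply: Rdiv_bounds; lra | apply: (proj2 (@Rdiv_bounds _ _ 0 _ _ _)); lra].
Qed.

Lemma twisted_bounds4 : exists A B, [/\ -0.57728 <= A <= -0.57727, -0.24806 <= B <= -0.24801 &
  forall N s, (2000 <= N)%N -> Rabs s <= 1 ->
  Rabs (twisted_mertens (chi 4) s N - (ln (INR N) + A + s * B)) <= 0.3651].
Proof.
have [L [HL Hg H]] := twisted_bounds (d := 4%N) isT kernel_ok4 tail_ok4.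
have [HA H2] := zeta_constants; have Hln2 := ln2_bounds.
have /and5P[N1 N2 N3 N4 N5] := numerics4.
move: (confined_sound HL N1) (confined_sound Hg N2) (confined_sound (encloses_V 4) N3)
  (confined_sound (@encloses_steps 4%N isT) N4) (confined_sound (@encloses_log_over (c_L 4) isT) N5).
move: (log2_of _ / _) (lin (absc c_zeta) _ / _) (IZR _ * L) (Vsum _ _) (lin (absc (c_L 4)) _)
  (lin (steps 4) _) H HA H2 => A b0 g V b1 u H HA H2 HL' Hg' HV HS H1.
exists A, (V / L); split; [exact: HA | by apply: Rdiv_bounds; lra |].
move=> N s HN Hs; apply: Rle_trans (H N s HN Hs) _.
(* The bound 0.3651 is made of 2 log 2 times 0.240284 for the kernels, about 0.3331, and of 0.02202
   and 0.00993 for the two asymptotics. *)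
have Hg2 := @Rdiv_bounds b1 g 0 0.00993 ltac:(lra) ltac:(lra).
nra.
Qed.

Lemma twisted_bounds3 : exists A B, [/\ -0.57728 <= A <= -0.57727, -0.37042 <= B <= -0.37034 &
  forall N s, (2000 <= N)%N -> Rabs s <= 1 ->
  Rabs (twisted_mertens (chi 3) s N - (ln (INR N) + A + s * B)) <= 0.3354].
Proof.
have [L [HL Hg H]] := twisted_bounds (d := 3%N) isT kernel_ok3 tail_ok3.
have [HA H2] := zeta_constants; have Hln2 := ln2_bounds.
have /and5P[N1 N2 N3 N4 N5] := numerics3.
move: (confined_sound HL N1) (confined_sound Hg N2) (confined_sound (encloses_V 3) N3)
  (confined_sound (@encloses_steps 3%N isT) N4) (confined_sound (@encloses_log_over (c_L 3) isT) N5).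
move: (log2_of _ / _) (lin (absc c_zeta) _ / _) (IZR _ * L) (Vsum _ _) (lin (absc (c_L 3)) _)
  (lin (steps 3) _) H HA H2 => A b0 g V b1 u H HA H2 HL' Hg' HV HS H1.
exists A, (V / L); split; [exact: HA | by apply: Rdiv_bounds; lra |].
move=> N s HN Hs; apply: Rle_trans (H N s HN Hs) _.
have Hg2 := @Rdiv_bounds b1 g 0 0.00957 ltac:(lra) ltac:(lra).
nra.
Qed.

(** * The range N >= 2000 and the extrema *)

Lemma EZ_numerics :
  [&& confined 216350 216360 (EI 4), confined 692460 692480 (ZI 4), confined 228484 228485 (squaresI 4),
      confined 339530 339540 (EI 3), confined 548550 548560 (ZI 3), confined 351390 351400 (squaresI 3) &
      confined 7600000 7610000 (logI 2000)].
Proof. by vm_compute. Qed.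

Lemma ramified_sum_mono d X N : (X <= N)%N -> Zsum d X <= Zsum d N.
Proof.
move=> HN; apply: sum1_mono => // k Hk.
apply: Rle_mult_inv_pos; last by apply: INR_gt0; lia.
by rewrite /ramified; case: ifP => _; [exact: Lam_ge0 | lra].
Qed.

Lemma evens_sum_mono d X N : (X <= N)%N -> Esum d X <= Esum d N.
Proof.
move=> HN; apply: sum1_mono => // k Hk.
apply: Rle_mult_inv_pos; last by apply: INR_gt0; lia.
by rewrite /evens; case: ifP => _; [exact: LambdaDA_ge0 | lra].
Qed.

Lemma INR_2000 : INR 2000 = 2000.
Proof. by rewrite INR_IZR_INZ. Qed.

Lemma log_tail_small : (ln (INR 2000) + 1) / INR 2000 <= 0.0044.
Proof.
have /and5P[_ _ _ _ /and3P[_ _ H]] := EZ_numerics.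
have := confined_sound (@encloses_log 2000 isT) H; move: (ln (INR 2000)) => x Hx.
rewrite INR_2000; lra.
Qed.

Lemma evens_sum_le d N : d \in [:: 3; 4]%N -> (2000 <= N)%N ->
  Esum d N <= squares_sum d 2000 + 0.0044.
Proof.
move=> Hd HN; have := Esum_le_squares N Hd.
have := @squares_sum_tail d 2000 N isT HN; have := log_tail_small.
have HN0 : (0 < N)%N by apply: leq_trans HN.
have : 0 <= (ln (INR N) + 1) / INR N.
  by apply: Rle_mult_inv_pos; [have := ln_ge0 (INR_ge1 HN0); lra | exact: INR_gt0].
move: (_ / INR 2000) (_ / INR N) (Esum _ _) (squares_sum d 2000) (squares_sum d N); move=> *; lra.
Qed.

Lemma ln_succ_small N : (2000 <= N)%N -> ln (INR N.+1) <= ln (INR N) + 0.0006.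
Proof.
move=> HN; have H0 : 2000 <= INR N by rewrite -INR_2000; apply/le_INR/leP.
have [_ H1] := @ln_succ_bounds (INR N) ltac:(lra); rewrite -S_INR in H1.
have : 1 / INR N <= 1 / 2000 by rewrite /Rdiv !Rmult_1_l; apply: Rinv_le_contravar; lra.
lra.
Qed.

(** s = 1 and s = -1 give the two classes. The even powers lie between their value at 2000 and the
    sum over squares, the powers of 2 between their value at 2000 and log 2. The tightest conclusion
    is the first, whose worst case is about -1.175. *)
Lemma Hsum_large4 N : (2000 <= N)%N ->
  (-1.18 <= Hsum 4 1 N - ln (INR N.+1) / 2 /\ Hsum 4 1 N - ln (INR N) / 2 <= 0) /\
  (-0.6 <= Hsum 4 3 N - ln (INR N.+1) / 2 /\ Hsum 4 3 N - ln (INR N) / 2 <= 0).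
Proof.
move=> HN; have [A [B [HA HB H]]] := twisted_bounds4.
have Hp := H N 1 HN ltac:(rewrite Rabs_R1; lra).
have Hm := H N (-1) HN ltac:(rewrite Rabs_Ropp Rabs_R1; lra).
have [E1 E2] := @Hsum_twisted 4%N N isT.
have /and5P[N1 N2 N3 _ _] := EZ_numerics.
move: (confined_sound (encloses_E (d := 4%N) isT) N1) (confined_sound (encloses_Z 4) N2)
  (confined_sound (encloses_squares (d := 4%N) isT) N3) (@evens_sum_mono 4 _ _ HN) (@ramified_sum_mono 4 _ _ HN)
  (@evens_sum_le 4%N _ isT HN) (@ramified_sum_le 4%N N isT) (ln_succ_small HN) ln2_bounds.
rewrite [pdiv 4]/= (_ : INR 2 = 2); last by rewrite /=; lra.
move: E1 E2 Hp Hm; rewrite [4.-1]/=.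
move: (Hsum 4 1 N) (Hsum 4 3 N) (twisted_mertens _ 1 N) (twisted_mertens _ (-1) N) (Esum 4 2000)
  (Zsum 4 2000) (squares_sum 4 2000) (Esum 4 N) (Zsum 4 N) (ln (INR N)) (ln (INR N.+1)).
move=> h1 h3 t1 t3 e0 z0 q0 e z x x' E1 E2 /Rabs_le_between Hp /Rabs_le_between Hm *.
by repeat split; lra.
Qed.

Lemma Hsum_large3 N : (2000 <= N)%N ->
  (-1.3 <= Hsum 3 1 N - ln (INR N.+1) / 2 /\ Hsum 3 1 N - ln (INR N) / 2 <= 0) /\
  (-0.3 <= Hsum 3 2 N - ln (INR N.+1) / 2 /\ Hsum 3 2 N - ln (INR N) / 2 <= 0.2).
Proof.
move=> HN; have [A [B [HA HB H]]] := twisted_bounds3.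
have Hp := H N 1 HN ltac:(rewrite Rabs_R1; lra).
have Hm := H N (-1) HN ltac:(rewrite Rabs_Ropp Rabs_R1; lra).
have [E1 E2] := @Hsum_twisted 3%N N isT.
have /and5P[_ _ _ N1 /and3P[N2 N3 _]] := EZ_numerics.
move: (confined_sound (encloses_E (d := 3%N) isT) N1) (confined_sound (encloses_Z 3) N2)
  (confined_sound (encloses_squares (d := 3%N) isT) N3) (@evens_sum_mono 3 _ _ HN) (@ramified_sum_mono 3 _ _ HN)
  (@evens_sum_le 3%N _ isT HN) (@ramified_sum_le 3%N N isT) (ln_succ_small HN) ln3_bounds.
rewrite [pdiv 3]/= (_ : INR 3 = 3); last by rewrite /=; lra.
move: E1 E2 Hp Hm; rewrite [3.-1]/=.
move: (Hsum 3 1 N) (Hsum 3 2 N) (twisted_mertens _ 1 N) (twisted_mertens _ (-1) N) (Esum 3 2000)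
  (Zsum 3 2000) (squares_sum 3 2000) (Esum 3 N) (Zsum 3 N) (ln (INR N)) (ln (INR N.+1)).
move=> h1 h3 t1 t3 e0 z0 q0 e z x x' E1 E2 /Rabs_le_between Hp /Rabs_le_between Hm *.
by repeat split; lra.
Qed.

(** * From integers to real x, and the extrema *)

Lemma H_Hsum x d a : H x d a = Hsum d a (Z.to_nat (Int_part x)).
Proof.
rewrite /H /Hsum; elim: (Z.to_nat _) => // n IH.
have Hcat : forall s1 s2, foldr Rplus 0 (s1 ++ s2) = foldr Rplus 0 s1 + foldr Rplus 0 s2.
  by elim=> [|y s1 IH1] s2 /=; [lra | rewrite IH1; ring].
rewrite -{1}[n.+1]addn1 iotaD map_cat Hcat IH add1n.
set f := fun n => LambdaDA d a n / INR n.
by rewrite -[RHS]/(sum1 f n + f n.+1) -[foldr _ _ _]/(f n.+1 + 0) Rplus_0_r.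
Qed.

Lemma Int_part_nat x : 1 <= x ->
  let N := Z.to_nat (Int_part x) in (0 < N)%N /\ INR N <= x < INR N.+1.
Proof.
move=> Hx N; have [H1 H2] := base_Int_part x.
have Hz : (0 < Int_part x)%Z by apply: lt_IZR; lra.
have E : INR N = IZR (Int_part x) by rewrite /N INR_IZR_INZ Z2Nat.id //; lia.
split; first by rewrite /N; lia.
rewrite S_INR E; lra.
Qed.

(** Between consecutive integers H is constant and the logarithm increases, so the value at N bounds
    from above and the left limit at N + 1 from below. *)
Lemma Fda_bounds d a x lo hi : 1 <= x ->
  (forall N, (0 < N)%N -> lo <= Hsum d a N - ln (INR N.+1) / 2 /\ Hsum d a N - ln (INR N) / 2 <= hi) ->
  lo <= Fda d a x <= hi.
Proof.
move=> Hx Hb; have [HN [H1 H2]] := Int_part_nat Hx; move: HN H1 H2.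
rewrite /Fda H_Hsum; set N := Z.to_nat _ => HN H1 H2.
have [Hlo Hhi] := Hb N HN; have HN0 := INR_gt0 HN.
have := ln_le_mono HN0 H1; have := @ln_le_mono x (INR N.+1) ltac:(lra) ltac:(lra); lra.
Qed.

Lemma Fda_at d a N x : (0 < N)%N -> INR N <= x < INR N.+1 -> Fda d a x = Hsum d a N - ln x / 2.
Proof.
move=> HN Hx; rewrite /Fda H_Hsum (_ : Int_part x = Z.of_nat N) ?Nat2Z.id //.
by symmetry; apply: Int_part_spec; rewrite -INR_IZR_INZ S_INR in Hx *; lra.
Qed.

(** The least upper bound of the negated values, with its sign changed. *)
Lemma glb_exists d a lo : (forall x, 1 <= x -> lo <= Fda d a x) ->
  exists2 c, Cminus_is d a c & lo <= c.
Proof.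
move=> Hlo; have [||c [Hc1 Hc2]] := @completeness (fun y => valsF d a (- y)).
- by exists (- lo) => y [x [Hx Ey]]; have := Hlo x Hx; lra.
- by exists (- Fda d a 1), 1; split; lra.
exists (- c).
  split=> [y Hy|b Hb]; first by have := Hc1 (- y); rewrite Ropp_involutive => /(_ Hy); lra.
  have : c <= - b by apply: Hc2 => y Hy; have := Hb _ Hy; lra.
  lra.
have : c <= - lo by apply: Hc2 => y [x [Hx Ey]]; have := Hlo x Hx; lra.
lra.
Qed.

Lemma lub_exists d a hi : (forall x, 1 <= x -> Fda d a x <= hi) ->
  exists2 c, Cplus_is d a c & c <= hi.
Proof.
move=> Hhi; have [||c Hc] := @completeness (valsF d a).
- by exists hi => y [x [Hx ->]]; exact: Hhi.
- by exists (Fda d a 1), 1; split; lra.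
by exists c => //; case: Hc => _; apply=> y [x [Hx ->]]; exact: Hhi.
Qed.

(* The infimum is approached as x increases to N + 1, along x = (N + 1) e^(-t). *)
Lemma glb_left_limit d a N v : (0 < N)%N -> v = Hsum d a N - ln (INR N.+1) / 2 ->
  (forall x, 1 <= x -> v <= Fda d a x) -> Cminus_is d a v.
Proof.
move=> HN Ev Hv; split=> [y [x [Hx ->]]|b Hb]; first exact: Hv.
apply: Rle_plus_epsilon => eps Heps.
have HN1 := @INR_gt0 N.+1 isT; have HN0 := INR_ge1 HN.
(* The bound 1/(N+1) keeps x >= N, since (N+1) e^(-t) >= (N+1)(1 - t); the bound [eps] controls the
   excess t/2 over the limit value. *)
set t := Rmin eps (/ INR N.+1).
have Ht0 : 0 < t by apply: Rmin_pos => //; exact: Rinv_0_lt_compat.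
have Hte : t <= eps by exact: Rmin_l.
have HtN : t <= / INR N.+1 by exact: Rmin_r.
have Hexp : 1 - t <= exp (- t) by have := exp_ineq1_le (- t); lra.
have Hexp1 : exp (- t) < 1 by rewrite -exp_0; apply: exp_increasing; lra.
have Hx : INR N <= INR N.+1 * exp (- t) < INR N.+1.
  split; last by nra.
  have : INR N.+1 * t <= INR N.+1 * / INR N.+1 by apply: Rmult_le_compat_l; lra.
  rewrite Rinv_r; last lra.
  have := Rmult_le_compat_l _ _ _ (Rlt_le _ _ HN1) Hexp; have := S_INR N.
  move: (INR N.+1) (INR N) => p q; lra.
have := Hb (Fda d a (INR N.+1 * exp (- t))).
rewrite (Fda_at d a HN Hx) ln_mult //; last exact: exp_pos.
rewrite ln_exp => /(_ _) H; apply: Rle_trans (H _) _.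
  exists (INR N.+1 * exp (- t)); split; first lra.
  by rewrite (Fda_at d a HN Hx) ln_mult //; [rewrite ln_exp | exact: exp_pos].
by rewrite Ev; lra.
Qed.

(** The supremum is attained at x = 1, where the sum and the logarithm both vanish. *)
Lemma lub_zero d a : (forall x, 1 <= x -> Fda d a x <= 0) -> Cplus_is d a 0.
Proof.
move=> Hx; split=> [y [x [H1 ->]]|b Hb]; first exact: Hx.
apply: Hb; exists 1; split; first lra.
rewrite (@Fda_at d a 1) //; last by rewrite /=; lra.
by rewrite /Hsum /= /LambdaDA /= ln_1; lra.
Qed.

Lemma Hsum_all41 N : (0 < N)%N ->
  -1.18 <= Hsum 4 1 N - ln (INR N.+1) / 2 /\ Hsum 4 1 N - ln (INR N) / 2 <= 0.
Proof.
move=> HN; case: (leqP 2000 N) => HN3; first by have [] := Hsum_large4 HN3.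
have [|H1 H2] := @Hsum_range 4 1 _ _ _ _ isT Hsum_range41 N; first by rewrite HN ltnW.
split; first by have := H1 isT; lra.
case: (eqVneq N 1%N) => [->|Hne]; first by rewrite /Hsum /= /LambdaDA /= ln_1; lra.
by have := H2; rewrite inE => /(_ Hne); lra.
Qed.

Lemma Hsum_all31 N : (0 < N)%N ->
  -1.3 <= Hsum 3 1 N - ln (INR N.+1) / 2 /\ Hsum 3 1 N - ln (INR N) / 2 <= 0.
Proof.
move=> HN; case: (leqP 2000 N) => HN3; first by have [] := Hsum_large3 HN3.
have [|H1 H2] := @Hsum_range 3 1 _ _ _ _ isT Hsum_range31 N; first by rewrite HN ltnW.
split; first by have := H1 isT; lra.
case: (eqVneq N 1%N) => [->|Hne]; first by rewrite /Hsum /= /LambdaDA /= ln_1; lra.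
by have := H2; rewrite inE => /(_ Hne); lra.
Qed.

Lemma ln7_bounds : 1.945909 <= ln 7 <= 1.945911.
Proof.
have H : confined 1945909 1945911 (logI 7) by vm_compute.
have := confined_sound (@encloses_log 7 isT) H.
by rewrite (_ : INR 7 = 7); [lra | rewrite /=; lra].
Qed.

Lemma Hsum_43_6 : Hsum 4 3 6 = ln 3 / 3.
Proof.
rewrite /Hsum; cbn [sum1].
have -> : LambdaDA 4 3 1 = 0 by [].
have -> : LambdaDA 4 3 2 = 0 by [].
have -> : LambdaDA 4 3 3 = ln (INR 3) by [].
have -> : LambdaDA 4 3 4 = 0 by [].
have -> : LambdaDA 4 3 5 = 0 by [].
have -> : LambdaDA 4 3 6 = 0 by [].
by rewrite (_ : INR 3 = 3); [rewrite /Rdiv; ring | rewrite /=; lra].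
Qed.

Lemma Hsum_all43 N : (0 < N)%N ->
  ln 3 / 3 - ln 7 / 2 <= Hsum 4 3 N - ln (INR N.+1) / 2 /\ Hsum 4 3 N - ln (INR N) / 2 <= 0.
Proof.
have := ln7_bounds; have := ln3_bounds => H3 H7 HN.
case: (leqP 2000 N) => HN3; first by have [_ [H1 H2]] := Hsum_large4 HN3; lra.
have [|H1 H2] := @Hsum_range 4 3 _ _ _ _ isT Hsum_range43 N; first by rewrite HN ltnW.
split.
  case: (eqVneq N 6%N) => [->|Hne].
    by rewrite Hsum_43_6 (_ : INR 7 = 7); [lra | rewrite /=; lra].
  by have := H1; rewrite inE => /(_ Hne); lra.
case: (eqVneq N 1%N) => [->|Hne]; first by rewrite /Hsum /= /LambdaDA /= ln_1; lra.
by have := H2; rewrite inE => /(_ Hne); lra.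
Qed.

Lemma Hsum_all32 N : (0 < N)%N ->
  - (ln 2 / 2) <= Hsum 3 2 N - ln (INR N.+1) / 2 /\ Hsum 3 2 N - ln (INR N) / 2 <= 0.2.
Proof.
have := ln2_bounds => H2 HN.
case: (leqP 2000 N) => HN3; first by have [_ [H3 H4]] := Hsum_large3 HN3; lra.
have [|Hlo Hhi] := @Hsum_range 3 2 _ _ _ _ isT Hsum_range32 N; first by rewrite HN ltnW.
split; last by have := Hhi isT; lra.
case: (eqVneq N 1%N) => [->|H1].
  by rewrite /Hsum /= /LambdaDA /= (_ : 1 + 1 = 2); lra.
case: (eqVneq N 3%N) => [->|H3].
  rewrite /Hsum; cbn [sum1].
  have -> : LambdaDA 3 2 1 = 0 by [].
  have -> : LambdaDA 3 2 2 = ln (INR 2) by [].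
  have -> : LambdaDA 3 2 3 = 0 by [].
  rewrite (_ : INR 2 = 2); last by rewrite /=; lra.
  rewrite (_ : INR 4 = 4); last by rewrite /=; lra.
  rewrite ln4 /Rdiv !Rmult_0_l; lra.
have := Hlo; rewrite !inE negb_or H1 H3 => /(_ isT); lra.
Qed.

Theorem theorem5 :
  (* (a) *)
  ((exists c, Cminus_is 4 1 c /\ c > - (1202 / 1000)) /\ Cplus_is 4 1 0) /\
  (* (b) *)
  (Cminus_is 4 3 (ln 3 / 3 - ln 7 / 2) /\ Cplus_is 4 3 0) /\
  (* (c) *)
  ((exists c, Cminus_is 3 1 c /\ c > - (14 / 10)) /\ Cplus_is 3 1 0) /\
  (* (d) *)
  (Cminus_is 3 2 (- (ln 2 / 2)) /\ (exists c, Cplus_is 3 2 c /\ c < 2764 / 10000)).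
Proof.
have H41 := fun x Hx => @Fda_bounds 4 1 x _ _ Hx Hsum_all41.
have H43 := fun x Hx => @Fda_bounds 4 3 x _ _ Hx Hsum_all43.
have H31 := fun x Hx => @Fda_bounds 3 1 x _ _ Hx Hsum_all31.
have H32 := fun x Hx => @Fda_bounds 3 2 x _ _ Hx Hsum_all32.
split; [|split; [|split]]; split.
- have [c Hc Hle] := glb_exists (fun x Hx => proj1 (H41 x Hx)).
  by exists c; split=> //; lra.
- exact: lub_zero (fun x Hx => proj2 (H41 x Hx)).
(* The infimum is the left limit at 7, just before the prime following 3 in the class 3 (mod 4). *)
- apply: (@glb_left_limit 4 3 6) (fun x Hx => proj1 (H43 x Hx)) => //.
  by rewrite Hsum_43_6 (_ : INR 7 = 7) //; rewrite /=; lra.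
- exact: lub_zero (fun x Hx => proj2 (H43 x Hx)).
- have [c Hc Hle] := glb_exists (fun x Hx => proj1 (H31 x Hx)).
  by exists c; split=> //; lra.
- exact: lub_zero (fun x Hx => proj2 (H31 x Hx)).
(* The left limit at 2, where the sum is still empty; the left limit at 4 has the same value. *)
- apply: (@glb_left_limit 3 2 1) (fun x Hx => proj1 (H32 x Hx)) => //.
  by rewrite /Hsum /= /LambdaDA /= (_ : 1 + 1 = 2); lra.
- have [c Hc Hle] := lub_exists (fun x Hx => proj2 (H32 x Hx)).
  by exists c; split=> //; lra.
Qed.
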